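(* Let $\mathcal{D}$ be an essentially small $k$-linear triangulated category, let $\mathfrak{d}$ be the set of isomorphism classes of non-zero objects of $\mathcal{D}$, and let $\mathrm{Stab}(\mathcal{D})$ be the space of stability conditions on $\mathcal{D}$ satisfying the support property with respect to a fixed surjection $v:K_0(\mathcal{D})\to\Lambda$. Then the map $\mathrm{d}m:\mathrm{Stab}(\mathcal{D})\to\mathscr{M}(\mathbf{R})^{\mathfrak{d}}$, $\sigma\mapsto(\mathrm{d}m_{\sigma,E})_{E\in\mathfrak{d}}$, is a homeomorphism onto its image when $\mathscr{M}(\mathbf{R})^{\mathfrak{d}}$ is equipped with the strong topology.
   Context: $k$ is a field. A pre-stability condition $\sigma=(Z,\mathcal{P})$ on $\mathcal{D}$ consists of a group homomorphism $Z:K_0(\mathcal{D})\to\mathbf{C}$ and a slicing, i.e. a collection $\mathcal{P}=\{\mathcal{P}(\phi)\}_{\phi\in\mathbf{R}}$ of full additive subcategories of $\mathcal{D}$, such that: (a) $\mathrm{Hom}(\mathcal{P}(\phi),\mathcal{P}(\psi))=0$ if $\phi>\psi$; (b) $\mathcal{P}(\phi)[1]=\mathcal{P}(\phi+1)$; (c) every non-zero object $E$ has a Harder--Narasimhan (HN) filtration $0=E_0\to E_1\to\cdots\to E_n=E$ whose successive cones $G_i$ (the HN factors, unique up to isomorphism) are non-zero objects of $\mathcal{P}(\phi_i)$ with $\phi_1>\cdots>\phi_n$; (d) $Z(E)\in\mathbf{R}_{>0}e^{i\pi\phi}$ for every non-zero $E\in\mathcal{P}(\phi)$. Fix a surjective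 homomorphism $v:K_0(\mathcal{D})\to\Lambda$ to an abelian group of finite positive rank. The pair $(Z,\mathcal{P})$ satisfies the support property if $Z$ factors through $v$ and, for a norm $\|\cdot\|$ on $\Lambda_{\mathbf{R}}=\Lambda\otimes\mathbf{R}$, $\inf\{|Z(E)|/\|v(E)\|:0\ne E\in\mathcal{P}(\phi),\phi\in\mathbf{R}\}>0$ (this implies each $\mathcal{P}(\phi)$ is a finite length abelian category). For a non-zero $E$ with HN factors $G_i\in\mathcal{P}(\phi_i)$, $i=1,\dots,n$: $\phi^+_\sigma(E)=\phi_1$, $\phi^-_\sigma(E)=\phi_n$, $m_\sigma(E)=\sum_i|Z(G_i)|$, and $\mathrm{d}m_{\sigma,E}=\sum_i|Z(G_i)|\,\delta_{\phi_i}$. $\mathrm{Stab}(\mathcal{D})$ has the topology of the generalized metric $d(\sigma,\tau)=\sup_{0\ne E}\{|\phi^+_\sigma(E)-\phi^+_\tau(E)|,|\phi^-_\sigma(E)-\phi^-_\tau(E)|,|\log\frac{m_\tau(E)}{m_\sigma(E)}|\}$. $\mathscr{M}(\mathbf{R})$ is the set of non-zero, finitely supported, non-negative measures on $\mathbf{R}$. For $\mu=\sum a_i\delta_{\theta_i}$ with all $a_i>0$, set $m(\mu)=\sum a_i$, $\phi^+(\mu)=\max\theta_i$, $\phi^-(\mu)=\min\theta_i$. Let $\mathscr{M}_{\le d}(\mathbf{R})$ be the subset of measures with at most $d$ support points, with the quotient topology from the surjection $\mathbf{R}^d\times\mathbf{R}_{>0}^d\to\mathscr{M}_{\le d}(\mathbf{R})$,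 $(\theta_1,\dots,\theta_d,t_1,\dots,t_d)\mapsto\sum t_i\delta_{\theta_i}$. The strong topology on $\mathscr{M}(\mathbf{R})$ is the direct limit topology of $\mathscr{M}(\mathbf{R})=\varinjlim_d\mathscr{M}_{\le d}(\mathbf{R})$. The strong topology on $\mathscr{M}(\mathbf{R})^{\mathfrak{d}}$ is the subspace topology induced by the injection $\mathscr{M}(\mathbf{R})^{\mathfrak{d}}\to\mathscr{M}(\mathbf{R})^{\mathfrak{d}}\times(\mathbf{R}^3)^{\mathfrak{d}}$, $(\mu_E)_E\mapsto\big((\mu_E)_E,(\log m(\mu_E),\phi^+(\mu_E),\phi^-(\mu_E))_E\big)$, where the target is the product of $\mathscr{M}(\mathbf{R})^{\mathfrak{d}}$ (product topology, each factor with the strong topology) and $(\mathbf{R}^3)^{\mathfrak{d}}$ with the uniform topology, given by the generalized metric $\sup_{E}\|x_E-y_E\|$.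
   Formalization: ''Abelian group of finite positive rank'' is taken to mean that Λ modulo torsion is isomorphic to Z^n with n > 0; for non-lattice groups of finite rank the support property does not give finite length and dm can fail to be continuous. *)

(* Defs.v *)
From HB Require Import structures.
From mathcomp Require Import all_boot all_order all_algebra.
From mathcomp Require Import generic_quotient ring_quotient.
From mathcomp.multinomials Require Import freeg.
From mathcomp Require Import complex.
From mathcomp Require Import all_classical all_reals all_analysis.
Import Order.TTheory GRing.Theory Num.Theory.
Import numFieldNormedType.Exports.

Set Implicit Arguments.
Unset Strict Implicit.
Unset Printing Implicit Defensive.

Local Open Scope classical_set_scope.
Local Open Scope ring_scope.

Definition free_ab (X : Type) := {freeg {classic X} / int}.

Definition gen (X : Type) (x : X) : free_ab X :=
  Freeg [:: (1, x : {classic X})].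

Section Presentation.
Variables (X : Type) (rels : set (free_ab X)).

(* The subgroup generated by [rels]. *)
Definition rel_subgroup : {pred free_ab X} := fun z =>
  `[< forall S : {pred free_ab X}, zmod_closed S ->
      (forall r, rels r -> r \in S) -> z \in S >].

Lemma rel_subgroup_closed : zmod_closed rel_subgroup.
Proof.
split; first by apply/asboolP => S [].
move=> x y /asboolP hx /asboolP hy; apply/asboolP => S cS hS.
by case: (cS) => _; apply; [exact: hx|exact: hy].
Qed.

HB.instance Definition _ :=
  GRing.isZmodClosed.Build (free_ab X) rel_subgroup rel_subgroup_closed.

Definition presented_ab : Type := @Quotient.quot (free_ab X) rel_subgroup.

HB.instance Definition _ := GRing.Zmodule.on presented_ab.

Definition presented_class (z : free_ab X) : presented_ab :=
  (\pi_(@Quotient.quot (free_ab X) rel_subgroup) z)%qT.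

End Presentation.
Arguments presented_class {X} rels z.

Lemma free_ab_eq (X : Type) (M : zmodType) (f g : free_ab X -> M) :
  zmod_morphism f -> zmod_morphism g ->
  (forall x, f (gen x) = g (gen x)) -> f =1 g.
Proof.
move=> fB gB fg z.
pose fA := GRing.isZmodMorphism.Build _ _ f fB.
pose gA := GRing.isZmodMorphism.Build _ _ g gB.
pose f' : {additive free_ab X -> M} := HB.pack f fA.
pose g' : {additive free_ab X -> M} := HB.pack g gA.
rewrite -[f z]/(f' z) -[g z]/(g' z) -(freeg_sumE z) !raddf_sum.
apply: eq_bigr => x _.
have -> : Freeg [:: (coeff x z, x)] = gen x *~ coeff x z.
  by rewrite /gen freeg_mulz mulrzz mul1r.
by rewrite !raddfMz; congr (_ *~ _); exact: fg.
Qed.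

Lemma presented_class_zmod_morphism (X : Type) (rels : set (free_ab X)) :
  zmod_morphism (presented_class rels).
Proof. exact: (raddfB (\pi_(@Quotient.quot (free_ab X) (rel_subgroup rels)))%qT). Qed.

Lemma presented_classP (X : Type) (rels : set (free_ab X)) x y :
  presented_class rels x = presented_class rels y <->
  x - y \in rel_subgroup rels.
Proof.
rewrite (Quotient.idealrBE (rel_subgroup rels)); split=> [/eqP//|/eqP//].
Qed.

Lemma presented_class_surj (X : Type) (rels : set (free_ab X))
  (u : presented_ab rels) : exists x, u = presented_class rels x.
Proof. by exists (repr u); rewrite /presented_class reprK. Qed.

Section RealExtension.
Variables (R : realType) (L : zmodType).

(* [real_ext] is the tensor product of L with R over the integers. *)
Definition tensor_rels : set (free_ab (L * R)) := [set z |
  (exists a b r, z = gen (a + b, r) - gen (a, r) - gen (b, r)) \/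
  (exists a r s, z = gen (a, r + s) - gen (a, r) - gen (a, s))].

Definition real_ext : Type := presented_ab tensor_rels.

HB.instance Definition _ := GRing.Zmodule.on real_ext.

Definition pure_tensor (a : L) (r : R) : real_ext := presented_class tensor_rels (gen (a, r)).

Definition free_scale (c : R) : free_ab (L * R) -> free_ab (L * R) :=
  fglift (fun p : {classic (L * R)} => gen (p.1, c * p.2)).

Lemma free_scale_zmod c : zmod_morphism (free_scale c).
Proof. exact: lift_is_additive. Qed.

Lemma free_scale_gen c p : free_scale c (gen p) = gen (p.1, c * p.2).
Proof. by rewrite /free_scale liftU scale1r. Qed.

HB.instance Definition _ c :=
  GRing.isZmodMorphism.Build _ _ (free_scale c) (free_scale_zmod c).

Lemma free_scale_rels c z : z \in rel_subgroup tensor_rels ->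
  free_scale c z \in rel_subgroup tensor_rels.
Proof.
move=> /asboolP hz.
apply: (hz [pred z | free_scale c z \in rel_subgroup tensor_rels]).
  split=> [|x y].
    by change (free_scale c 0 \in rel_subgroup tensor_rels); rewrite raddf0 rpred0.
  move=> hx hy; change (free_scale c (x - y) \in rel_subgroup tensor_rels).
  by rewrite raddfB rpredB.
move=> r hr; change (free_scale c r \in rel_subgroup tensor_rels).
apply/asboolP => S cS hS; apply: hS.
case: hr => [[a [b [s ->]]]|[a [s [t ->]]]]; rewrite !free_scale_zmod !free_scale_gen/=.
  by left; exists a, b, (c * s).
by right; exists a, (c * s), (c * t); rewrite mulrDr.
Qed.

Definition real_ext_scale (c : R) (u : real_ext) : real_ext :=
  presented_class tensor_rels (free_scale c (repr (u : Quotient.quot (rel_subgroup tensor_rels)))).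

Lemma real_ext_scale_class c x :
  real_ext_scale c (presented_class tensor_rels x) =
  presented_class tensor_rels (free_scale c x).
Proof.
apply/presented_classP; rewrite -free_scale_zmod; apply: free_scale_rels.
by apply/presented_classP; rewrite /presented_class reprK.
Qed.

Lemma real_ext_scaleA a b u :
  real_ext_scale a (real_ext_scale b u) = real_ext_scale (a * b) u.
Proof.
have [x ->] := presented_class_surj u; rewrite !real_ext_scale_class.
congr (presented_class _ _); move: x.
apply: (@free_ab_eq _ _ (free_scale a \o free_scale b)) => [x y|x y|p].
- by rewrite /= !raddfB.
- by rewrite raddfB.
- by rewrite /= !free_scale_gen /= mulrA.
Qed.

Lemma real_ext_scale1 : left_id 1 real_ext_scale.
Proof.
move=> u; have [x ->] := presented_class_surj u; rewrite real_ext_scale_class.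
congr (presented_class _ _); move: x.
apply: (@free_ab_eq _ _ (free_scale 1) id) => [x y|//|[p r]].
  by rewrite raddfB.
by rewrite free_scale_gen /= mul1r.
Qed.

Lemma real_ext_scaleDr : right_distributive real_ext_scale +%R.
Proof.
move=> c u w; have [x ->] := presented_class_surj u.
have [y ->] := presented_class_surj w.
rewrite -[_ + _ in LHS](raddfD (\pi_(@Quotient.quot _ (rel_subgroup tensor_rels)))%qT).
rewrite -/(presented_class tensor_rels _) !real_ext_scale_class raddfD.
exact: (raddfD (\pi_(@Quotient.quot _ (rel_subgroup tensor_rels)))%qT).
Qed.

Lemma real_ext_scaleDl u : {morph real_ext_scale^~ u : a b / a + b}.
Proof.
move=> a b; have [x ->] := presented_class_surj u.
rewrite !real_ext_scale_class.
rewrite -[RHS](raddfD (\pi_(@Quotient.quot _ (rel_subgroup tensor_rels)))%qT).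
rewrite -/(presented_class tensor_rels _).
pose f z := presented_class tensor_rels (free_scale (a + b) z).
pose g z := presented_class tensor_rels (free_scale a z + free_scale b z).
apply: (@free_ab_eq _ _ f g) => [z t|z t|p].
- by rewrite /f raddfB presented_class_zmod_morphism.
- by rewrite /g -presented_class_zmod_morphism !raddfB /= opprD addrACA.
- rewrite /f /g !free_scale_gen mulrDl; apply/presented_classP.
  rewrite opprD addrA; apply/asboolP => S cS hS; apply: hS.
  by right; exists p.1, (a * p.2), (b * p.2).
Qed.

HB.instance Definition _ := GRing.Zmodule_isLmodule.Build R real_ext
  real_ext_scaleA real_ext_scale1 real_ext_scaleDr real_ext_scaleDl.

End RealExtension.

Record linCat (k : fieldType) := LinCat {
  obj :> Type;
  hom : obj -> obj -> lmodType k;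
  idm : forall A, hom A A;
  comp : forall A B C, hom B C -> hom A B -> hom A C;
  compA : forall A B C D (h : hom C D) (g : hom B C) (f : hom A B),
    comp h (comp g f) = comp (comp h g) f;
  comp1m : forall A B (f : hom A B), comp (idm B) f = f;
  compm1 : forall A B (f : hom A B), comp f (idm A) = f;
  comp_linear_r : forall A B C (g : hom B C), linear (@comp A B C g);
  comp_linear_l : forall A B C (f : hom A B), linear (@comp A B C ^~ f) }.

Arguments hom {k l} A B.
Arguments idm {k l} A.
Arguments comp {k l A B C} g f.
Notation "g \oc f" := (comp g f) (at level 40, left associativity).

Section LinCatNotions.
Variables (k : fieldType) (D : linCat k).
Implicit Types A B S : D.

Definition is_zero_obj A := idm A = 0.

Definition is_iso A B (f : hom A B) :=
  exists g : hom B A, g \oc f = idm A /\ f \oc g = idm B.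

Definition isomorphic A B := exists f : hom A B, is_iso f.

Definition is_biproduct A B S :=
  exists (i1 : hom A S) (i2 : hom B S) (p1 : hom S A) (p2 : hom S B),
    [/\ p1 \oc i1 = idm A, p2 \oc i2 = idm B, p1 \oc i2 = 0, p2 \oc i1 = 0 &
        i1 \oc p1 + i2 \oc p2 = idm S].

End LinCatNotions.

(* The shift is a k-linear autoequivalence, not necessarily a strict
   automorphism; [dist f g h] says that A -f-> B -g-> C -h-> A[1] is a
   distinguished triangle. *)
Record triCat (k : fieldType) := TriCat {
  lincat_of :> linCat k;
  zero_obj_ex : exists A : lincat_of, is_zero_obj A;
  biproduct_ex : forall A B : lincat_of, exists S, is_biproduct A B S;
  sh : lincat_of -> lincat_of;
  shm : forall A B, {linear hom A B -> hom (sh A) (sh B)};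
  shm_id : forall A, shm A A (idm A) = idm (sh A);
  shm_comp : forall A B C (g : hom B C) (f : hom A B),
    shm A C (g \oc f) = shm B C g \oc shm A B f;
  shm_bij : forall A B, bijective (shm A B);
  sh_esurj : forall B, exists A, isomorphic (sh A) B;
  dist : forall A B C, hom A B -> hom B C -> hom C (sh A) -> Prop;
  dist_iso : forall A B C (f : hom A B) (g : hom B C) (h : hom C (sh A))
      A' B' C' (f' : hom A' B') (g' : hom B' C') (h' : hom C' (sh A'))
      (a : hom A A') (b : hom B B') (c : hom C C'),
    is_iso a -> is_iso b -> is_iso c ->
    b \oc f = f' \oc a -> c \oc g = g' \oc b -> shm A A' a \oc h = h' \oc c ->
    dist f g h -> dist f' g' h';
  dist_id : forall A Z, is_zero_obj Z ->
    dist (idm A) (0 : hom A Z) (0 : hom Z (sh A));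
  dist_cone : forall A B (f : hom A B),
    exists C (g : hom B C) (h : hom C (sh A)), dist f g h;
  dist_rot : forall A B C (f : hom A B) (g : hom B C) (h : hom C (sh A)),
    dist f g h <-> dist g h (- shm A B f);
  dist_mor : forall A B C (f : hom A B) (g : hom B C) (h : hom C (sh A))
      A' B' C' (f' : hom A' B') (g' : hom B' C') (h' : hom C' (sh A'))
      (a : hom A A') (b : hom B B'),
    dist f g h -> dist f' g' h' -> b \oc f = f' \oc a ->
    exists c : hom C C', c \oc g = g' \oc b /\ shm A A' a \oc h = h' \oc c;
  dist_oct : forall X Y Z X' Y' Z' (f : hom X Y) (g : hom Y Z)
      (i : hom Y Z') (i' : hom Z' (sh X)) (j : hom Z X') (j' : hom X' (sh Y))
      (l : hom Z Y') (l' : hom Y' (sh X)),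
    dist f i i' -> dist g j j' -> dist (g \oc f) l l' ->
    exists (u : hom Z' Y') (w : hom Y' X'),
      dist u w (shm Y Z' i \oc j') /\
      [/\ u \oc i = l \oc g, l' \oc u = i', w \oc l = j &
          j' \oc w = shm X Y f \oc l'] }.

Arguments sh {k t} A.
Arguments shm {k t A B}.
Arguments dist {k t A B C} f g h.

Section Grothendieck.
Variables (k : fieldType) (D : triCat k).

Definition K0_rels : set (free_ab D) := [set z |
  exists (A B C : D) (f : hom A B) (g : hom B C) (h : hom C (sh A)),
    dist f g h /\ z = gen B - gen A - gen C].

Definition K0 : Type := presented_ab K0_rels.

HB.instance Definition _ := GRing.Zmodule.on K0.

Definition K0_class (E : D) : K0 := presented_class K0_rels (gen E).

Definition nzobj := {E : D | ~ is_zero_obj E}.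

(* An isomorphism class is represented as a set of objects.  Smallness is a
   size condition: D has a type of objects, so the isomorphism classes form a
   type and nothing has to be assumed. *)
Definition iso_class : Type := {C : set D |
  exists E : D, ~ is_zero_obj E /\ C = [set F | isomorphic E F]}.

HB.instance Definition _ := gen_eqMixin iso_class.
HB.instance Definition _ := gen_choiceMixin iso_class.

Definition class_repr (c : iso_class) : nzobj :=
  exist _ (sval (cid (svalP c))) (svalP (cid (svalP c))).1.

End Grothendieck.

Section Slicings.
Variables (R : realType) (k : fieldType) (D : triCat k).
Implicit Types (P : R -> set D) (Z : K0 D -> R[i]).

(* Full subcategories are sets of objects; they are taken to be replete. *)
Definition additive_subcat (S : set D) :=
  [/\ forall A, is_zero_obj A -> S A,
      forall A B C, S A -> S B -> is_biproduct A B C -> S C &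
      forall A B, S A -> isomorphic A B -> S B].

(* [hn_tower P E s]: E is the end of a tower 0 = E_0 -> E_1 -> ... -> E_n = E
   whose i-th cone G_i is a nonzero object of P phi_i, where
   s = [:: (phi_1, G_1); ...; (phi_n, G_n)]. *)
Inductive hn_tower P : D -> seq (R * D) -> Prop :=
| hn_tower0 E : is_zero_obj E -> hn_tower P E [::]
| hn_towerS E' E G phi s (f : hom E' E) (g : hom E G) (h : hom G (sh E')) :
    hn_tower P E' s -> dist f g h -> P phi G -> ~ is_zero_obj G ->
    hn_tower P E (rcons s (phi, G)).

Definition is_HN P (E : D) (s : seq (R * D)) :=
  hn_tower P E s /\ sorted >%R [seq x.1 | x <- s].

Definition is_slicing P :=
  [/\ forall phi, additive_subcat (P phi),
      forall phi psi A B, psi < phi -> P phi A -> P psi B ->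
        forall f : hom A B, f = 0,
      forall phi F, P (phi + 1) F <-> exists2 E, P phi E & isomorphic (sh E) F &
      forall E, ~ is_zero_obj E -> exists s, is_HN P E s].

Definition is_prestability Z P :=
  [/\ zmod_morphism Z, is_slicing P &
      forall phi E, P phi E -> ~ is_zero_obj E -> exists2 r : R, 0 < r &
        Z (K0_class E) = (r%:C * (cos (pi * phi) +i* sin (pi * phi)))%C].

End Slicings.

(* The rank is that of the lattice image of L in its real extension: L modulo
   torsion is isomorphic to Z^n with n > 0.  This includes all finitely
   generated abelian groups of positive rank; groups such as the rationals,
   whose image in the real extension is not a lattice, are excluded. *)
Definition finite_positive_rank (L : zmodType) :=
  exists (n : nat) (p : {additive L -> 'rV[int]_n}),
    [/\ (0 < n)%N, (forall y, exists x, p x = y) &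
        forall x, p x = 0 -> exists2 m : nat, (0 < m)%N & x *+ m = 0].

Definition is_norm (R : realType) (V : lmodType R) (N : V -> R) :=
  [/\ forall x, 0 <= N x, forall x, N x = 0 -> x = 0,
      forall a x, N (a *: x) = `|a| * N x &
      forall x y, N (x + y) <= N x + N y].

Definition cabs (R : realType) (z : R[i]) : R := ComplexField.Normc.normc z.

Section Stab.
Variables (R : realType) (k : fieldType) (D : triCat k) (L : zmodType)
  (v : {additive K0 D -> L}).

Definition support_property (Z : K0 D -> R[i]) (P : R -> set D) :=
  (exists Zv : {additive L -> R[i]}, forall x, Z x = Zv (v x)) /\
  exists2 N : real_ext R L -> R, is_norm N &
    (0 < ereal_inf [set y | exists phi E, [/\ P phi E, ~ is_zero_obj E &
       y = (cabs (Z (K0_class E)) /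
            N (pure_tensor (v (K0_class E)) 1))%:E]])%E.

Record Stab := MkStab {
  charge : K0 D -> R[i];
  slice : R -> set D;
  stab_prestability : is_prestability charge slice;
  stab_support : support_property charge slice }.

HB.instance Definition _ := gen_eqMixin Stab.
HB.instance Definition _ := gen_choiceMixin Stab.

Lemma stab_HN_ex (sigma : Stab) (E : nzobj D) :
  exists s, is_HN (slice sigma) (sval E) s.
Proof.
by case: (stab_prestability sigma) => _ [_ _ _ h] _; apply: h; exact: svalP E.
Qed.

(* HN filtrations are unique up to isomorphism; one is chosen. *)
Definition HN (sigma : Stab) (E : nzobj D) : seq (R * D) :=
  sval (cid (stab_HN_ex sigma E)).

Definition phases sigma E : seq R := [seq x.1 | x <- HN sigma E].
Definition phase_max sigma E : R := head 0 (phases sigma E).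
Definition phase_min sigma E : R := last 0 (phases sigma E).
Definition mass sigma E : R :=
  \sum_(x <- HN sigma E) cabs (charge sigma (K0_class x.2)).

Definition stab_dist (sigma tau : Stab) : \bar R :=
  ereal_sup [set y : \bar R | exists E : nzobj D,
    [\/ y = `|phase_max sigma E - phase_max tau E|%:E,
        y = `|phase_min sigma E - phase_min tau E|%:E |
        y = `|ln (mass tau E / mass sigma E)|%:E]].

Definition stab_open (U : set Stab) := forall sigma, U sigma ->
  exists2 e : R, 0 < e & forall tau, (stab_dist sigma tau < e%:E)%E -> U tau.

Lemma stab_openT : stab_open setT.
Proof. by move=> sigma _; exists 1. Qed.

Lemma stab_openI : setI_closed stab_open.
Proof.
move=> U V oU oV sigma [/oU [e e0 he] /oV [d d0 hd]].
exists (Num.min e d); first by rewrite lt_min e0.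
by move=> tau; rewrite EFin_min lt_min => /andP[/he ? /hd].
Qed.

Lemma stab_open_bigU (I : Type) (F : I -> set Stab) :
  (forall i, stab_open (F i)) -> stab_open (\bigcup_i F i).
Proof.
move=> oF sigma [i _ /oF [e e0 he]]; exists e => // tau /he.
by exists i.
Qed.

HB.instance Definition _ :=
  isOpenTopological.Build Stab stab_openT stab_openI stab_open_bigU.

End Stab.

(* The coinduced topology: U is open iff all its preimages are. *)
Definition final_topology (I : Type) (X : I -> Type) (Y : Type)
  (f : forall i, X i -> Y) : Type := Y.

Section FinalTopology.
Variables (I : Type) (X : I -> topologicalType) (Y : choiceType)
  (f : forall i, X i -> Y).

Definition final_open (U : set Y) := forall i, open (@f i @^-1` U).

Lemma final_openT : final_open setT.
Proof. by move=> i; rewrite preimage_setT; exact: openT. Qed.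

Lemma final_openI : setI_closed final_open.
Proof. by move=> U V oU oV i; rewrite preimage_setI; exact: openI. Qed.

Lemma final_open_bigU (J : Type) (F : J -> set Y) :
  (forall j, final_open (F j)) -> final_open (\bigcup_j F j).
Proof.
by move=> oF i; rewrite preimage_bigcup; apply: bigcup_open => j _; exact: oF.
Qed.

HB.instance Definition _ := Choice.on (final_topology f).
HB.instance Definition _ := isOpenTopological.Build (final_topology f)
  final_openT final_openI final_open_bigU.

End FinalTopology.

Section FiniteMeasures.
Variable R : realType.

Notation borel_measure := {measure set (measurableTypeR R) -> \bar R}.

(* The measure \sum_i t_i \delta_(theta_i) for s = [:: (theta_1, t_1); ...]. *)
Fixpoint dirac_comb (s : seq (R * {nonneg R})) : borel_measure :=
  if s is x :: s' then
    measure_add (mscale x.2 (dirac (x.1 : measurableTypeR R))) (dirac_comb s')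
  else mzero.

Lemma dirac_combE s A :
  dirac_comb s A = (\sum_(x <- s) x.2%:num%:E * \d_(x.1) A)%E.
Proof.
elim: s => [|x s ih]; first by rewrite big_nil.
by rewrite big_cons -ih; exact: measure_addE.
Qed.

(* Library measures are defined on all sets; requiring equality with a Dirac
   combination on all sets, not only Borel ones, makes equality in [fsmeasure]
   equality of measures. *)
Definition is_fsmeasure (mu : borel_measure) := exists s,
  [/\ s != [::], all (fun x => 0 < x.2%:num) s & mu = dirac_comb s].

Definition fsmeasure : Type := {mu : borel_measure | is_fsmeasure mu}.

HB.instance Definition _ := gen_eqMixin fsmeasure.
HB.instance Definition _ := gen_choiceMixin fsmeasure.

Definition supp (mu : fsmeasure) : set R := [set x | sval mu [set x] != 0%E].
Definition meas_mass (mu : fsmeasure) : R := fine (sval mu setT).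
Definition meas_max (mu : fsmeasure) : R := sup (supp mu).
Definition meas_min (mu : fsmeasure) : R := inf (supp mu).

Definition fsmeasure_le (d : nat) : set fsmeasure := [set mu | (supp mu #<= `I_d)%card].

Definition pos_reals : set R := [set x | 0 < x].

Definition weighted_points (d : nat) : topologicalType :=
  (prod_topology (fun _ : 'I_d => R) *
   prod_topology (fun _ : 'I_d => set_type pos_reals))%type.

Lemma pos_reals_ge0 (t : set_type pos_reals) : 0 <= set_val t.
Proof. by apply/ltW; exact: (set_mem (svalP t)). Qed.

Definition points_seq d (x : weighted_points d) : seq (R * {nonneg R}) :=
  [seq (x.1 i, NngNum (pos_reals_ge0 (x.2 i))) | i <- enum 'I_d].

(* From here on the index d stands for d + 1 points: no measure in [fsmeasure]
   has an empty support. *)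
Lemma points_seq_neq0 d (x : weighted_points d.+1) : points_seq x != [::].
Proof. by rewrite -size_eq0 size_map size_enum_ord. Qed.

Lemma points_seq_gt0 d (x : weighted_points d) :
  all (fun y => 0 < y.2%:num) (points_seq x).
Proof.
by apply/allP => _ /mapP[i _ ->] /=; exact: (set_mem (svalP (x.2 i))).
Qed.

Lemma points_measure_proof d (x : weighted_points d.+1) :
  is_fsmeasure (dirac_comb (points_seq x)).
Proof. by exists (points_seq x); rewrite points_seq_neq0 points_seq_gt0. Qed.

Definition points_measure d (x : weighted_points d.+1) : fsmeasure :=
  exist _ _ (points_measure_proof x).

Lemma points_measure_le d (x : weighted_points d.+1) :
  points_measure x \in fsmeasure_le d.+1.
Proof.
rewrite inE /fsmeasure_le /=.
suff sub : supp (points_measure x) `<=` x.1 @` [set: 'I_d.+1].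
  apply: (card_le_trans (subset_card_le sub)).
  apply: (card_le_trans (card_image_le _ _)).
  by move: (@card_II d.+1); rewrite card_eq_le => /andP[_].
move=> y; rewrite /supp /= dirac_combE big_map big_enum => h.
apply: contrapT => hy; move/eqP: h; apply.
apply: big1 => i _; rewrite diracE memNset ?mule0 //= => yi.
by apply: hy; exists i.
Qed.

Definition points_measure_in d (x : weighted_points d.+1) :
  set_type (fsmeasure_le d.+1) :=
  exist (fun mu => mu \in fsmeasure_le d.+1) _ (points_measure_le x).

Definition fsmeasure_le_top (d : nat) : topologicalType :=
  final_topology (fun _ : unit => @points_measure_in d).

Definition strong_fsmeasure : topologicalType :=
  final_topology (fun (d : nat) (mu : fsmeasure_le_top d) =>
    set_val (mu : set_type (fsmeasure_le d.+1))).

Definition meas_coords (mu : fsmeasure) : R * R * R :=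
  (ln (meas_mass mu), meas_max mu, meas_min mu).

End FiniteMeasures.

Lemma cabs_ge0 (R : realType) (z : R[i]) : 0 <= cabs z.
Proof. by case: z => a b; exact: sqrtr_ge0. Qed.

Section MassMeasure.
Variables (R : realType) (k : fieldType) (D : triCat k) (L : zmodType)
  (v : {additive K0 D -> L}).
Implicit Types (sigma : Stab R v).

Definition HN_weights sigma (E : nzobj D) : seq (R * {nonneg R}) :=
  [seq (x.1, NngNum (cabs_ge0 (charge sigma (K0_class x.2))))
  | x <- HN sigma E].

Lemma HN_weights_gt0 sigma E :
  all (fun x => 0 < x.2%:num) (HN_weights sigma E).
Proof.
rewrite /HN_weights /HN; case: cid => s /= [tow _].
have [_ _ hZ] := stab_prestability sigma.
rewrite all_map; elim: tow => // E' F G phi {}s f g h _ ih _ PG nzG.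
rewrite all_rcons ih andbT /=; have [r r0 ->] := hZ _ _ PG nzG.
rewrite /cabs ComplexField.Normc.normcM /= expr0n /= addr0 sqrtr_sqr.
by rewrite cos2Dsin2 sqrtr1 mulr1 normr_gt0 gt_eqF.
Qed.

Lemma HN_weights_neq0 sigma E : HN_weights sigma E != [::].
Proof.
rewrite /HN_weights /HN; case: cid => s /= [tow _]; rewrite -size_eq0 size_map.
move: (svalP E) tow; move: (sval E) => E0 nz tow.
by case: tow nz => // *; rewrite size_rcons.
Qed.

Lemma mass_measure_proof sigma E : is_fsmeasure (dirac_comb (HN_weights sigma E)).
Proof.
by exists (HN_weights sigma E); rewrite HN_weights_neq0 HN_weights_gt0.
Qed.

Definition mass_measure sigma E : fsmeasure R :=
  exist _ _ (mass_measure_proof sigma E).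

Definition measure_family := prod_topology (fun _ : iso_class D => strong_fsmeasure R).

Definition measure_family_coords (mu : measure_family) :
    (measure_family * {uniform iso_class D -> R * R * R})%type :=
  (mu, fun c => meas_coords (mu c)).

Definition strong_measure_family : topologicalType :=
  initial_topology measure_family_coords.

Definition dm sigma : strong_measure_family :=
  fun c : iso_class D => mass_measure sigma (class_repr c).

End MassMeasure.

Definition homeomorphism_onto_image (S T : topologicalType) (f : S -> T) :=
  [/\ continuous f, injective f &
      exists2 g : set_type (range f) -> S,
        continuous g & forall y, f (g y) = set_val y].

(* Main.v *)
(* If d(sigma, tau) is small, the tau-HN filtration of E refines the sigma-HN
   filtration: the tau-HN factors of the successive sigma-factors have phases
   close to phi_1 > ... > phi_n, so by the octahedral axiom they concatenate to
   a tau-HN filtration of E, and uniqueness applies.  Hence the integral of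
   every continuous function against dm_{tau,E} tends to its integral against
   dm_{sigma,E}.  By the support property and the discreteness of the lattice,
   every nonzero object has sigma-mass at least some c > 0; as semistable
   objects have tau-mass |Z_tau|, all weights of dm_{tau,E} are at least c / e,
   which bounds the number of HN factors and confines the data to compact
   boxes.  There the convergence of polynomial moments upgrades to convergence
   in the quotient topologies defining the strong topology.

   Conversely, the uniform coordinates (log m, phi^+, phi^-) of dm_{sigma,E}
   determine the distance on Stab, which gives the continuity of the inverse;
   they also determine the slicing (phi^+ = phi^- = phi on P(phi)), hence
   the charge on semistable objects and, by additivity, everywhere. *)
Require Import Defs.
From HB Require Import structures.
From mathcomp Require Import all_boot all_order all_algebra.
From mathcomp Require Import generic_quotient ring_quotient.
From mathcomp.multinomials Require Import freeg.
From mathcomp Require Import complex.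
From mathcomp Require Import all_classical all_reals all_analysis.
From mathcomp Require Import lra.
Import Order.TTheory GRing.Theory Num.Theory.
Import numFieldNormedType.Exports.
Import Defs.
Set Implicit Arguments.
Unset Strict Implicit.
Unset Printing Implicit Defensive.

Local Open Scope classical_set_scope.
Local Open Scope ring_scope.

(** * Triangulated categories *)

Section Triangulated.
Variables (k : fieldType) (D : triCat k).
Implicit Types A B C E F G H X Y : D.

Lemma comp0m A B C (f : hom A B) : (0 : hom B C) \oc f = 0.
Proof.
have /eqP := comp_linear_l f 1 (0 : hom B C) 0.
by rewrite !scale1r !addr0 addrC -subr_eq subrr => /eqP.
Qed.

Lemma compm0 A B C (g : hom B C) : g \oc (0 : hom A B) = 0.
Proof.
have /eqP := comp_linear_r g 1 (0 : hom A B) 0.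
by rewrite !scale1r !addr0 addrC -subr_eq subrr => /eqP.
Qed.

Lemma compBm A B C (g g' : hom B C) (f : hom A B) :
  (g - g') \oc f = g \oc f - g' \oc f.
Proof.
have h := comp_linear_l f (-1) g' g.
by rewrite /= !scaleN1r in h; rewrite addrC h addrC.
Qed.

Lemma compmB A B C (g : hom B C) (f f' : hom A B) :
  g \oc (f - f') = g \oc f - g \oc f'.
Proof.
have h := comp_linear_r g (-1) f' f.
by rewrite /= !scaleN1r in h; rewrite [f - f']addrC h addrC.
Qed.

Lemma compNm A B C (g : hom B C) (f : hom A B) : (- g) \oc f = - (g \oc f).
Proof. by rewrite -sub0r compBm comp0m sub0r. Qed.

Lemma compmN A B C (g : hom B C) (f : hom A B) : g \oc (- f) = - (g \oc f).
Proof. by rewrite -sub0r compmB compm0 sub0r. Qed.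

Lemma is_iso_id A : is_iso (idm A).
Proof. by exists (idm A); rewrite comp1m. Qed.

Lemma is_isoN A B (f : hom A B) : is_iso f -> is_iso (- f).
Proof.
by case=> g [gf fg]; exists (- g); rewrite !compNm !compmN !opprK.
Qed.

Lemma isomorphic_refl A : isomorphic A A.
Proof. by exists (idm A); exact: is_iso_id. Qed.

Lemma isomorphic_sym A B : isomorphic A B -> isomorphic B A.
Proof. by case=> f [g [gf fg]]; exists g, f. Qed.

Lemma zero_obj_homl A B (f : hom A B) : is_zero_obj A -> f = 0.
Proof. by move=> zA; rewrite -(compm1 f) zA compm0. Qed.

Lemma zero_obj_homr A B (f : hom A B) : is_zero_obj B -> f = 0.
Proof. by move=> zB; rewrite -(comp1m f) zB comp0m. Qed.

Lemma isomorphic_zero A B : isomorphic A B -> is_zero_obj A -> is_zero_obj B.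
Proof.
case=> f [g [_ fg]] zA; rewrite /is_zero_obj -fg.
by rewrite (zero_obj_homr g zA) compm0.
Qed.

Lemma sh_zero A : is_zero_obj A -> is_zero_obj (sh A).
Proof. by move=> zA; rewrite /is_zero_obj -shm_id zA raddf0. Qed.

Lemma shm_inj A B : injective (@shm k D A B).
Proof. exact: (bij_inj (shm_bij A B)). Qed.

Lemma shm_surj A B (f : hom (sh A) (sh B)) : exists g, f = shm g.
Proof. by have [s _ h] := shm_bij A B; exists (s f). Qed.

Lemma sh_isomorphic A B : isomorphic (sh A) (sh B) -> isomorphic A B.
Proof.
case=> f [g [gf fg]]; have [f' ef] := shm_surj f; have [g' eg] := shm_surj g.
exists f', g'; split; apply: shm_inj.
  by rewrite shm_comp -ef -eg gf shm_id.
by rewrite shm_comp -ef -eg fg shm_id.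
Qed.

(** * Exactness of Hom on distinguished triangles *)

Section Exactness.
Variables (E' E G : D) (f : hom E' E) (g : hom E G) (h : hom G (sh E')).
Hypothesis dfgh : dist f g h.

(** A rotated identity triangle [Z -> H = H] with [Z] zero receives a morphism of triangles
    extending [u]; its third component is the factorization. *)
Lemma dist_colift H (u : hom E H) : u \oc f = 0 -> exists w, w \oc g = u.
Proof.
move=> uf; have [Z zZ] := zero_obj_ex D.
have dH : dist (0 : hom Z H) (idm H) (0 : hom H (sh Z)).
  by apply/dist_rot; rewrite raddf0 oppr0; apply: dist_id; exact: sh_zero.
have [c [e _]] := dist_mor (a := 0) dfgh dH
  (etrans uf (esym (compm0 _ _))).
by exists c; rewrite e comp1m.
Qed.

(** The given triangle and the identity triangle of [X] are both rotated once, so the third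
    component goes between shifts; full faithfulness of the shift brings it back. *)
Lemma dist_lift X (u : hom X E) : g \oc u = 0 -> exists w, f \oc w = u.
Proof.
move=> gu; have [Z zZ] := zero_obj_ex D.
have dX := (dist_rot _ _ _).1 (dist_id X zZ).
have dG := (dist_rot _ _ _).1 dfgh.
have [c [_ e]] := dist_mor (b := 0) dX dG (etrans (comp0m _ _) (esym gu)).
have [w ew] := shm_surj c; exists w; apply: shm_inj.
move: e; rewrite shm_id compmN compm1 compNm => /oppr_inj ->.
by rewrite shm_comp ew.
Qed.

End Exactness.

Lemma dist_colift_rot E' E G H (f : hom E' E) (g : hom E G)
    (h : hom G (sh E')) (u : hom G H) :
  dist f g h -> u \oc g = 0 -> exists r, r \oc h = u.
Proof. by move=> /dist_rot/dist_colift; exact. Qed.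

(** With [E'] zero, [g] has a left inverse [w]; the defect [idm G - g \oc w] kills [g], hence
    factors through the zero object [sh E']. *)
Lemma dist_isor E' E G (f : hom E' E) (g : hom E G) (h : hom G (sh E')) :
  dist f g h -> is_zero_obj E' -> isomorphic E G.
Proof.
move=> d zE'; have [w wg] : exists w, w \oc g = idm E.
  by apply: (dist_colift d); rewrite comp1m; exact: zero_obj_homl.
exists g, w; split=> //.
have [r] : exists r, r \oc h = idm G - g \oc w.
  by apply: (dist_colift_rot d); rewrite compBm -compA wg compm1 comp1m subrr.
by rewrite (zero_obj_homl r (sh_zero zE')) comp0m => /esym/subr0_eq.
Qed.

Lemma dist_isol E' E G (f : hom E' E) (g : hom E G) (h : hom G (sh E')) :
  dist f g h -> is_zero_obj G -> isomorphic E' E.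
Proof.
move=> d zG; have /dist_rot d' := d.
have := dist_isor (proj1 (dist_rot _ _ _) d') zG.
exact: sh_isomorphic.
Qed.

(** Three rotations negate all three shifted maps; the sign -1 on the middle object removes two of
    the signs. *)
Lemma dist_unsh A B C (f : hom A B) (g : hom B C) (h : hom C (sh A)) :
  dist (shm f) (shm g) (- shm h) -> dist f g h.
Proof.
move=> d; apply/dist_rot/dist_rot/dist_rot.
apply: (dist_iso (is_iso_id _) (is_isoN (is_iso_id _)) (is_iso_id _) _ _ _ d).
- by rewrite compNm comp1m compm1.
- by rewrite comp1m compmN compm1 opprK.
- by rewrite shm_id !comp1m compm1.
Qed.

(* The octahedral axiom for fibres instead of cones. *)
Lemma dist_fibre_oct E' E G G' H (f : hom E' E) (g : hom E G) (h : hom G (sh E'))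
    (a : hom G' G) (b : hom G H) (c : hom H (sh G')) :
  dist f g h -> dist a b c ->
  exists E'' (u : hom E' E'') (w : hom E'' G') (x : hom G' (sh E'))
    (p : hom E'' E) (l : hom H (sh E'')),
    dist u w x /\ dist p (b \oc g) l.
Proof.
move=> /dist_rot d1 /dist_rot d2.
have [Y [l [l' d3]]] := dist_cone (b \oc g).
have [E'' [t it]] := sh_esurj Y.
have [t' [t't tt']] := it.
have d4 : dist (b \oc g) (t' \oc l) (l' \oc t).
  apply: (dist_iso (is_iso_id _) (is_iso_id _) (c := t') _ _ _ _ d3).
  - by exists t.
  - by rewrite comp1m compm1.
  - by rewrite compm1.
  - by rewrite shm_id comp1m -compA tt' compm1.
have [q eq] := shm_surj (l' \oc t).
(* The octahedron relates the cones [sh E'], [sh G'] and [sh E''] of [g], [b] and [b \oc g]; its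
   triangle is then unshifted. *)
have [u [w [d5 _]]] := dist_oct d1 d2 d4.
have [u0 eu] := shm_surj u; have [w0 ew] := shm_surj w.
(* The sign in [- q] compensates the one in the rotation axiom. *)
exists E'', u0, w0, (h \oc a), (- q), (t' \oc l); split.
  by apply: dist_unsh; rewrite -eu -ew shm_comp -compmN.
apply/dist_rot; suff -> : - shm (- q) = l' \oc t by [].
by rewrite eq raddfN opprK.
Qed.

Lemma K0_class_dist A B C (f : hom A B) (g : hom B C) (h : hom C (sh A)) :
  dist f g h -> K0_class B = K0_class A + K0_class C.
Proof.
move=> d; apply/eqP; rewrite -subr_eq0 opprD addrA /K0_class.
rewrite -!presented_class_zmod_morphism; apply/eqP.
rewrite -(raddf0 (\pi_(@Quotient.quot (free_ab D) (rel_subgroup (@K0_rels k D))))%qT).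
apply/presented_classP; rewrite subr0; apply/asboolP => S cS; apply.
by exists A, B, C, f, g, h.
Qed.

Lemma K0_class_zero A : is_zero_obj A -> K0_class A = 0.
Proof.
move=> zA; have /K0_class_dist/eqP := dist_id A zA.
by rewrite addrC -subr_eq subrr => /eqP.
Qed.

Lemma K0_class_iso A B : isomorphic A B -> K0_class A = K0_class B.
Proof.
case=> f iso_f; have [Z zZ] := zero_obj_ex D.
have d : dist f (0 : hom B Z) (0 : hom Z (sh A)).
  apply: (dist_iso (is_iso_id _) iso_f (is_iso_id _) _ _ _ (dist_id A zZ)).
  - by rewrite compm1.
  - by rewrite compm0 comp0m.
  - by rewrite compm0 comp0m.
by rewrite (K0_class_dist d) (K0_class_zero zZ) addr0.
Qed.

End Triangulated.

(** * Harder-Narasimhan filtrations *)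

Section Slicing.
Variables (R : realType) (k : fieldType) (D : triCat k) (P : R -> set D).
Hypothesis slP : is_slicing P.
Implicit Types (E F G H : D) (s t : seq (R * D)).

Lemma slice_iso phi E F : P phi E -> isomorphic E F -> P phi F.
Proof. by case: slP => /(_ phi)[_ _ h] _ _ _; exact: h. Qed.

Lemma slice_zero phi E : is_zero_obj E -> P phi E.
Proof. by case: slP => /(_ phi)[h _ _] _ _ _; exact: h. Qed.

Lemma slice_hom0 phi psi E F (f : hom E F) :
  psi < phi -> P phi E -> P psi F -> f = 0.
Proof. by case: slP => _ h _ _ lt PE PF; exact: (h phi psi). Qed.

Lemma slice_unsh phi E : P phi E -> exists2 F, P (phi - 1) F & isomorphic (sh F) E.
Proof. by case: slP => _ _ /(_ (phi - 1) E) h _ PE; apply/h; rewrite subrK. Qed.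

Lemma hn_tower_iso E F s : hn_tower P E s -> isomorphic E F -> hn_tower P F s.
Proof.
case=> [{}E zE /isomorphic_zero|E' {}E G phi {}s f g h tow d PG nzG].
  by move=> /(_ zE); exact: hn_tower0.
move=> [a [a' [a'a aa']]].
apply: (hn_towerS (f := a \oc f) (g := g \oc a') (h := h) tow _ PG nzG).
apply: (dist_iso (is_iso_id _) (b := a) _ (is_iso_id _) _ _ _ d).
- by exists a'.
- by rewrite compm1.
- by rewrite comp1m -compA a'a compm1.
- by rewrite shm_id comp1m compm1.
Qed.

(** By induction on the tower [u] vanishes on [E'], so it factors through the last cone [G], where
    the slicing axiom applies. *)
Lemma hn_tower_hom0 E s psi F (u : hom E F) :
  hn_tower P E s -> all (fun x => psi < x.1) s -> P psi F -> u = 0.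
Proof.
move=> tow; elim: tow u => {E s} [E zE u _ _|]; first exact: zero_obj_homl.
move=> E' E G phi s f g h _ ih d PG _ u; rewrite all_rcons => /andP[lt al] PF.
have [w <-] := dist_colift d (ih (u \oc f) al PF).
by rewrite (slice_hom0 w lt PG PF) comp0m.
Qed.

(** Writing [F] as a shift of an object of phase [psi - 1] turns [u] into a map from [E] to an even
    lower phase. *)
Lemma hn_tower_sh_hom0 E s psi F (u : hom (sh E) F) :
  hn_tower P E s -> all (fun x => psi < x.1) s -> P psi F -> u = 0.
Proof.
move=> tow al /slice_unsh[F' PF' [a [a' [a'a aa']]]].
have [w ew] := shm_surj (a' \oc u).
have w0 : w = 0.
  apply: (hn_tower_hom0 w tow) PF'; apply: sub_all al => x /= lt.
  by apply: le_lt_trans lt; rewrite gerBl.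
by rewrite -(comp1m u) -aa' -compA ew w0 raddf0 compm0.
Qed.

(** If [f \oc x] is zero, [shm x] lifts along [h] to a map from [sh X] to [G], which vanishes by
    hypothesis. *)
Lemma dist_fibre_mono X E' E G (f : hom E' E) (g : hom E G) (h : hom G (sh E'))
    (x : hom X E') :
  dist f g h -> (forall w : hom (sh X) G, w = 0) -> f \oc x = 0 -> x = 0.
Proof.
move=> /dist_rot/dist_rot d hom0 fx; apply: shm_inj.
have [w <-] : exists w, h \oc w = shm x.
  by apply: (dist_lift d); rewrite compNm -shm_comp fx raddf0 oppr0.
by rewrite (hom0 w) compm0 raddf0.
Qed.

Lemma dist_cone_epi X E' E G (f : hom E' E) (g : hom E G) (h : hom G (sh E'))
    (x : hom G X) :
  dist f g h -> (forall w : hom (sh E') X, w = 0) -> x \oc g = 0 -> x = 0.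
Proof.
by move=> d hom0 /(dist_colift_rot d)[w <-]; rewrite (hom0 w) comp0m.
Qed.

(** The first two vanishing conditions give comparison maps in both directions; the two on shifts
    make such maps unique, so the composites are identities. *)
Lemma truncation_unique E' E G (f : hom E' E) (g : hom E G) (h : hom G (sh E'))
    F' H (f' : hom F' E) (g' : hom E H) (h' : hom H (sh F')) :
  dist f g h -> dist f' g' h' ->
  (forall u : hom E' H, u = 0) -> (forall u : hom F' G, u = 0) ->
  (forall u : hom (sh E') G, u = 0) -> (forall u : hom (sh F') H, u = 0) ->
  isomorphic E' F' /\ isomorphic G H.
Proof.
move=> d d' E'H F'G sE'G sF'H; split.
  have [a fa] := dist_lift d' (E'H (g' \oc f)).
  have [b fb] := dist_lift d (F'G (g \oc f')).
  have ba0 : b \oc a - idm E' = 0.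
    by apply: (dist_fibre_mono d) => //; rewrite compmB compA fb fa compm1 subrr.
  have ab0 : a \oc b - idm F' = 0.
    by apply: (dist_fibre_mono d') => //; rewrite compmB compA fa fb compm1 subrr.
  by exists a, b; split; apply/subr0_eq.
have [a ag] := dist_colift d (E'H (g' \oc f)).
have [b bg] := dist_colift d' (F'G (g \oc f')).
have ba0 : b \oc a - idm G = 0.
  by apply: (dist_cone_epi d) => //; rewrite compBm -compA ag bg comp1m subrr.
have ab0 : a \oc b - idm H = 0.
  by apply: (dist_cone_epi d') => //; rewrite compBm -compA bg ag comp1m subrr.
by exists a, b; split; apply/subr0_eq.
Qed.

Lemma sorted_gt_rcons s x :
  sorted >%R [seq y.1 | y <- rcons s x] =
  all (fun y => x.1 < y.1) s && sorted >%R [seq y.1 | y <- s].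
Proof.
rewrite map_rcons !(sorted_pairwise (rev_trans lt_trans)) pairwise_rcons.
by rewrite all_map.
Qed.

(** If [g] were zero, the identity of [G] would factor through [sh E'], which has no nonzero map to
    [G]. *)
Lemma hn_cone_neq0 E' E G phi s (f : hom E' E) (g : hom E G) (h : hom G (sh E')) :
  dist f g h -> hn_tower P E' s -> all (fun x => phi < x.1) s -> P phi G ->
  ~ is_zero_obj G -> g <> 0.
Proof.
move=> d tow al PG nzG g0; apply: nzG.
have [|r rh] := dist_colift_rot (u := idm G) d; first by rewrite comp1m.
by rewrite /is_zero_obj -rh (hn_tower_sh_hom0 r tow al PG) comp0m.
Qed.

(** Cones enter through their classes in [K0], so uniqueness up to isomorphism becomes an equality
    of lists. *)
Definition hn_data s := [seq (x.1, K0_class x.2) | x <- s].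

(** The last triangles are compared first: once the last phases agree, [truncation_unique]
    identifies cones and fibres, and the induction continues with the fibres. *)
Lemma is_HN_unique E s t : is_HN P E s -> is_HN P E t -> hn_data s = hn_data t.
Proof.
case=> tow + []; elim: tow t => {E s}
  [E zE t _ towt|E' E G phi s f g h tow ih d PG nzG t].
  case: towt zE => // F' F H psi {}t f' g' h' towt d PH nzH zF.
  rewrite sorted_gt_rcons => /andP[al _].
  by case: (hn_cone_neq0 d towt al PH nzH); exact: zero_obj_homl.
rewrite sorted_gt_rcons => /andP[al srt] towt.
case: towt f g d => [{}E zE|F' {}E H psi {}t f' g' h' towt d' PH nzH] f g d.
  by case: (hn_cone_neq0 d tow al PG nzG); exact: zero_obj_homl.
rewrite sorted_gt_rcons => /andP[al' srt'].
have towE := hn_towerS tow d PG nzG; have towE' := hn_towerS towt d' PH nzH.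
have sub x y (r : seq (R * D)) : x <= y -> all (fun z => y < z.1) r ->
    all (fun z => x < z.1) r.
  by move=> xy; apply: sub_all => z /=; exact: le_lt_trans.
(* A tower with larger last phase has no nonzero map to the last cone of the other, against
   [hn_cone_neq0]. *)
have [lt|gt|epp] := ltgtP phi psi.
- case: (hn_cone_neq0 d tow al PG nzG).
  by apply: (hn_tower_hom0 g towE' _ PG); rewrite all_rcons lt (sub _ psi)// ltW.
- case: (hn_cone_neq0 d' towt al' PH nzH).
  by apply: (hn_tower_hom0 g' towE _ PH); rewrite all_rcons gt (sub _ phi)// ltW.
rewrite -{}epp in PH al' towE' *.
have [isoE isoG] : isomorphic E' F' /\ isomorphic G H.
  apply: (truncation_unique d d') => u.
  - exact: hn_tower_hom0 tow al PH.
  - exact: hn_tower_hom0 towt al' PG.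
  - exact: hn_tower_sh_hom0 tow al PG.
  - exact: hn_tower_sh_hom0 towt al' PH.
rewrite /hn_data !map_rcons /= (K0_class_iso isoG); congr rcons.
by apply: ih => //; exact: hn_tower_iso towt (isomorphic_sym isoE).
Qed.

(** Induction on the tower of [G]: if [H] is its last cone, the fibre of [E -> G -> H] is an
    extension of the smaller [G'] by [E'], to which the induction hypothesis applies. *)
Lemma hn_tower_cat E' E G s t (f : hom E' E) (g : hom E G) (h : hom G (sh E')) :
  hn_tower P E' s -> dist f g h -> hn_tower P G t -> hn_tower P E (s ++ t).
Proof.
move=> towE' + tow; elim: tow E f g h => {G t}
  [G zG E f g h d|G' G H phi t a b c _ ih d' PH nzH E f g h d].
  by rewrite cats0; apply: (hn_tower_iso towE'); exact: dist_isol d zG.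
have [E'' [u [w [x [p [l [d1 d2]]]]]]] := dist_fibre_oct d d'.
rewrite -rcons_cat; apply: (hn_towerS _ d2 PH nzH).
exact: ih d1.
Qed.

Lemma hn_tower1 E phi : P phi E -> ~ is_zero_obj E -> hn_tower P E [:: (phi, E)].
Proof.
move=> PE nzE; have [Z zZ] := zero_obj_ex D.
have d : dist (0 : hom Z E) (idm E) (0 : hom E (sh Z)).
  by apply/dist_rot; rewrite raddf0 oppr0; apply: dist_id; exact: sh_zero.
exact: (hn_towerS (s := [::]) (hn_tower0 P zZ) d PE nzE).
Qed.

Lemma hn_tower_seq1 E phi G : hn_tower P E [:: (phi, G)] -> P phi E.
Proof.
move=> tow; move e : [:: _] tow => t tow.
case: tow e => // E' {}E {}G' psi s f g h towE' d PG _.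
case: s towE' => [towE'|x [|? ?] _] //= [-> _].
have zE' : is_zero_obj E'.
  by move e : [::] towE' => s tow; case: tow e => // ? ? ? ? [].
by apply: (slice_iso PG); apply: isomorphic_sym; exact: dist_isor d zE'.
Qed.

End Slicing.

(** * Norms on the real extension of a lattice *)

Section RealExtensionNorm.
Variables (R : realType) (L : zmodType).
Implicit Types (a b : L) (r : R).

Lemma pure_tensorDl a b r : pure_tensor (a + b) r = pure_tensor a r + pure_tensor b r.
Proof.
apply/eqP; rewrite -subr_eq0 opprD addrA /pure_tensor.
rewrite -!presented_class_zmod_morphism; apply/eqP.
rewrite -(raddf0 (\pi_(@Quotient.quot _ (rel_subgroup (@tensor_rels R L))))%qT).
apply/presented_classP; rewrite subr0; apply/asboolP => S cS; apply.
by left; exists a, b, r.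
Qed.

Lemma pure_tensor_zmod_morphism r : zmod_morphism (@pure_tensor R L ^~ r).
Proof.
by move=> a b; apply/eqP; rewrite eq_sym subr_eq -pure_tensorDl subrK.
Qed.

Lemma scale_pure_tensor c a r : c *: pure_tensor a r = pure_tensor a (c * r).
Proof.
by rewrite /GRing.scale/= /pure_tensor real_ext_scale_class free_scale_gen.
Qed.

Section Functional.
Variable q : {additive L -> int}.

(** The extension of [q] to the tensor product, before passing to the quotient; [zmodule R] is [R]
    as a module over the integers. *)
Let tensor_functional : free_ab (L * R) -> zmodule R :=
  fglift (fun p : {classic (L * R)} => (q p.1)%:~R * p.2 : zmodule R).

Lemma tensor_functional_rels z :
  z \in rel_subgroup (@tensor_rels R L) -> tensor_functional z = 0.
Proof.
have TB : zmod_morphism tensor_functional by exact: lift_is_additive.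
have T0 : tensor_functional 0 = 0 by rewrite -(subrr 0) TB subrr.
have Tgen p : tensor_functional (gen p) = (q p.1)%:~R * p.2.
  by rewrite /tensor_functional liftU scale1r.
move=> /asboolP/(_ [pred z | tensor_functional z == 0]) hz; apply/eqP/hz.
  split=> [|x y]; rewrite !inE /=; first by rewrite T0.
  by move=> /eqP ex /eqP ey; rewrite TB ex ey subrr.
move=> _ [[a [b [r ->]]]|[a [r [s ->]]]]; rewrite inE /= !TB !Tgen /=.
  by rewrite raddfD /= intrD mulrDl addrAC addrK subrr.
by rewrite mulrDr addrAC addrK subrr.
Qed.

(** Serves to prove independence of pure tensors: applied to coordinate functionals [q], it reads
    off the coefficients of a relation. *)
Lemma sum_pure_tensor_eq0 n (x : 'I_n -> R) (b : 'I_n -> L) :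
  \sum_i pure_tensor (b i) (x i) = 0 -> \sum_i (q (b i))%:~R * x i = 0.
Proof.
pose cls : {additive free_ab (L * R) -> real_ext R L} := HB.pack
  (presented_class (@tensor_rels R L)) (GRing.isZmodMorphism.Build _ _ _
    (@presented_class_zmod_morphism _ (@tensor_rels R L))).
pose T : {additive free_ab (L * R) -> zmodule R} := HB.pack tensor_functional
  (GRing.isZmodMorphism.Build _ _ tensor_functional (@lift_is_additive _ _ _ _)).
have -> : \sum_i pure_tensor (b i) (x i) = cls (\sum_i gen (b i, x i)).
  by rewrite raddf_sum.
move=> e.
have : T (\sum_i gen (b i, x i)) = 0.
  apply: tensor_functional_rels; rewrite -[X in X \in _]subr0.
  by apply/presented_classP; rewrite [LHS]e -[LHS](raddf0 cls).
rewrite raddf_sum => T0; rewrite -[RHS]T0.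
apply: (@eq_bigr R 0 +%R) => i _.
by rewrite /= /tensor_functional liftU scale1r.
Qed.

End Functional.

End RealExtensionNorm.

(** The triangle inequality bounds [M] by the sup norm times the sum of its values on the standard
    basis, so [M] is Lipschitz. *)
Lemma seminorm_rV_continuous (R : realType) n (M : 'rV[R]_n -> R) :
  (forall a x, M (a *: x) = `|a| * M x) ->
  (forall x y, M (x + y) <= M x + M y) -> continuous M.
Proof.
move=> MZ MD.
have M0 : M 0 = 0 by rewrite -(scale0r 0) MZ normr0 mul0r.
have MN x : M (- x) = M x by rewrite -scaleN1r MZ normrN1 mul1r.
have M_ge0 x : 0 <= M x.
  rewrite -(@pmulr_lge0 _ 2)// mulr_natr mulr2n -{2}(MN x).
  by rewrite -M0 -(subrr x) MD.
have Msum (I : Type) (s : seq I) (F : I -> 'rV[R]_n) :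
    M (\sum_(i <- s) F i) <= \sum_(i <- s) M (F i).
  elim/big_ind2 : _ => [|x y z t xy zt|//]; first by rewrite M0.
  by rewrite (le_trans (MD _ _))// lerD.
pose C := \sum_(i < n) M (delta_mx 0 i).
have C_ge0 : 0 <= C by exact: sumr_ge0.
have bound x : M x <= C * `|x|.
  rewrite [x in M x]row_sum_delta (le_trans (Msum _ _ _))// mulr_suml.
  apply: ler_sum => i _; rewrite MZ mulrC ler_wpM2l//.
  by rewrite [leRHS]mx_normrE (le_bigmax _ _ (0, i)).
have diff x y : `|M x - M y| <= C * `|x - y|.
  suff h u v : M u - M v <= C * `|u - v|.
    by rewrite ler_norml lerNl opprB h distrC h.
  by rewrite (le_trans _ (bound _))// lerBlDr -{1}(subrK v u) MD.
move=> x A /nbhs_ballP[e /= e0 eA].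
(* [C] may be zero, so the radius is divided by [C + 1]. *)
have C1 : 0 < C + 1 by rewrite ltr_wpDl.
apply/nbhs_ballP; exists (e / (C + 1)) => /=; first by rewrite divr_gt0.
move=> y; rewrite -ball_normE /= => xy; apply: eA.
rewrite -ball_normE /=; apply: le_lt_trans (diff _ _) _.
rewrite (@le_lt_trans _ _ ((C + 1) * `|x - y|))//.
  by rewrite ler_wpM2r// lerDl.
by rewrite -ltr_pdivlMl// mulrC.
Qed.

(** Modulo torsion [L] is a standard lattice, and [N] pulls back to a norm on real row vectors. It
    is bounded below on the compact unit sphere, and nonzero integer vectors have sup norm at least
    1. *)
Lemma norm_lattice_bound (R : realType) (L : zmodType) (N : real_ext R L -> R) :
  finite_positive_rank L -> is_norm N ->
  exists2 c : R, 0 < c &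
    forall l : L, N (pure_tensor l 1) != 0 -> c <= N (pure_tensor l 1).
Proof.
case=> n [p [n0 psurj ptor]] [N_ge0 N_eq0 NZ ND].
have /boolp.choice[b pb] (i : 'I_n) : exists y, p y = delta_mx 0 i.
  exact: psurj.
pose pt : {additive L -> real_ext R L} := HB.pack (@pure_tensor R L ^~ 1)
  (GRing.isZmodMorphism.Build _ _ _ (pure_tensor_zmod_morphism 1)).
(* The difference between [l] and the lift of its coordinates is torsion, hence dies in the real
   extension, where positive integers are invertible. *)
have decomp l : pure_tensor l 1 =
    \sum_i ((p l 0 i)%:~R : R) *: pure_tensor (b i) 1.
  have [|m m0 /(congr1 pt)] := ptor (l - \sum_i b i *~ p l 0 i).
    rewrite raddfB raddf_sum [X in X - _]row_sum_delta; apply/eqP.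
    rewrite subr_eq0; apply/eqP/eq_bigr => i _.
    by rewrite raddfMz pb -scaler_int intz.
  rewrite (raddf0 pt) (raddfMn pt) (raddfB pt) (raddf_sum pt) -scaler_nat.
  move=> /eqP; rewrite scaler_eq0 pnatr_eq0 gtn_eqF//= subr_eq0 => /eqP ->.
  by apply: eq_bigr => i _; rewrite scaler_int -(raddfMz pt).
pose M (x : 'rV[R]_n) := N (\sum_i x 0 i *: pure_tensor (b i) 1).
have MZ a x : M (a *: x) = `|a| * M x.
  rewrite /M -NZ scaler_sumr; congr N; apply: eq_bigr => i _.
  by rewrite mxE scalerA.
have MD x y : M (x + y) <= M x + M y.
  rewrite /M (le_trans _ (ND _ _))// -big_split/= le_eqVlt; apply/orP; left.
  by apply/eqP; congr N; apply: eq_bigr => i _; rewrite mxE scalerDl.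
have M_eq0 x : M x = 0 -> x = 0.
  move=> /N_eq0 x0; apply/rowP => j; rewrite mxE.
  have qB : zmod_morphism (fun l => p l 0 j).
    by move=> l l'; rewrite raddfB !mxE.
  pose q : {additive L -> int} := HB.pack (fun l => p l 0 j)
    (GRing.isZmodMorphism.Build _ _ _ qB).
  have : \sum_i pure_tensor (b i) (x 0 i) = 0.
    by rewrite -[RHS]x0; apply: eq_bigr => i _; rewrite scale_pure_tensor mulr1.
  have qb i : q (b i) = (j == i)%:R.
    by rewrite -[q (b i)]/(p (b i) 0 j) pb mxE eqxx.
  move=> /(sum_pure_tensor_eq0 q); rewrite (bigD1 j)// qb eqxx mul1r.
  rewrite big1 => [|i /andP[_ ij]]; first by rewrite /= addr0.
  by rewrite qb eq_sym (negbTE ij) mul0r.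
have [c c0 cM] : exists2 c : R, 0 < c & forall x : 'rV[R]_n, `|x| = 1 -> c <= M x.
  have [[x0 x01]|] := pselect (exists x : 'rV[R]_n, `|x| = 1); last first.
    by move=> nex; exists 1 => // x x1; case: nex; exists x.
  have [||x] := @EVT_min_rV R n M [set x | `|x| = 1] (ex_intro _ x0 x01).
  - apply: bounded_closed_compact.
      exists 1; split; first by rewrite num_real.
      by move=> y y1 x /= ->; exact: ltW.
    apply: (@closed_comp _ _ (fun x : 'rV[R]_n => `|x|) [set 1]).
      by move=> x _; exact: norm_continuous.
    exact: closed_eq.
  - apply: continuous_subspaceT; exact: seminorm_rV_continuous.
  rewrite inE => /= x1 Mmin; exists (M x).
    rewrite lt_neqAle N_ge0 andbT eq_sym; apply/eqP => /M_eq0 xx.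
    by move: x1; rewrite xx normr0 => /eqP; rewrite eq_sym oner_eq0.
  by move=> y y1; apply: Mmin; rewrite inE.
exists c => // l; rewrite decomp => Nl.
pose x : 'rV[R]_n := map_mx intr (p l).
have Mx : N (\sum_i (p l 0 i)%:~R *: pure_tensor (b i) 1) = M x.
  by congr N; apply: eq_bigr => i _; rewrite mxE.
rewrite Mx in Nl *.
have xneq0 : x != 0.
  apply: contra Nl => /eqP ->; rewrite -(scale0r 0) MZ normr0 mul0r//.
have x1 : 1 <= `|x|.
  have [i xi] : exists i, x 0 i != 0.
    apply/existsP; apply: contraNT xneq0; rewrite negb_exists => /forallP h.
    by apply/eqP/rowP => i; rewrite [RHS]mxE; apply/eqP; rewrite -[_ == _]negbK.
  apply: (@le_trans _ _ `|x 0 i|); last first.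
    by rewrite [leRHS]mx_normrE (le_bigmax _ _ (0, i)).
  move: xi; rewrite mxE intr_eq0 -intr_norm ler1z; case: (p l 0 i) => [[]|] //.
have nx0 : 0 < `|x| by exact: lt_le_trans x1.
have := cM (`|x|^-1 *: x).
rewrite normrZ normfV normr_id mulVf ?gt_eqF// => /(_ erefl).
rewrite MZ normfV normr_id ler_pdivlMl//; apply: le_trans.
by rewrite ler_peMl// ltW.
Qed.

(** * Variation of the stability condition *)

Section StabilityConditions.
Variables (R : realType) (k : fieldType) (D : triCat k) (L : zmodType)
  (v : {additive K0 D -> L}).
Implicit Types (sigma tau : Stab R v) (E G : nzobj D).

Lemma stab_slicing sigma : is_slicing (slice sigma).
Proof. by case: (stab_prestability sigma). Qed.

Lemma HN_is_HN sigma E : is_HN (slice sigma) (sval E) (HN sigma E).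
Proof. by rewrite /HN; case: cid. Qed.

Definition HN_data sigma E := hn_data (HN sigma E).

Lemma HN_data_eq sigma E s :
  is_HN (slice sigma) (sval E) s -> HN_data sigma E = hn_data s.
Proof. exact: (is_HN_unique (stab_slicing sigma) (HN_is_HN sigma E)). Qed.

Lemma HN_data_iso sigma E G :
  isomorphic (sval E) (sval G) -> HN_data sigma E = HN_data sigma G.
Proof.
move=> EG; apply: HN_data_eq; have [tow srt] := HN_is_HN sigma G.
split=> //; apply: (hn_tower_iso tow).
exact: isomorphic_sym.
Qed.

Lemma phases_data sigma E : phases sigma E = [seq x.1 | x <- HN_data sigma E].
Proof. by rewrite /HN_data /hn_data -map_comp. Qed.

Lemma HN_data_neq0 sigma E : HN_data sigma E != [::].
Proof. by have := HN_weights_neq0 sigma E; rewrite -!size_eq0 !size_map. Qed.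

Lemma phases_neq0 sigma E : phases sigma E != [::].
Proof. by rewrite phases_data -size_eq0 size_map size_eq0 HN_data_neq0. Qed.

Lemma phases_sorted sigma E : sorted >%R (phases sigma E).
Proof. by have [] := HN_is_HN sigma E. Qed.

Lemma phases_bounds sigma E x : x \in phases sigma E ->
  phase_min sigma E <= x <= phase_max sigma E.
Proof.
rewrite /phase_min /phase_max; have := phases_sorted sigma E.
elim: (phases sigma E) x => // a s ih x /= srt.
have srt' : sorted >%R s by case: s srt {ih} => //= b s /andP[].
case: s srt srt' ih => [|b s] /=; first by rewrite inE => _ _ _ /eqP ->; rewrite lexx.
move=> /andP[ba srt] _ /(_ _ srt) ih; rewrite inE => /predU1P[->|xs].
  have /andP[+ _] := ih b (mem_head _ _).
  by move=> /le_trans ->; rewrite ?lexx// ltW.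
by have /andP[-> /le_trans ->] := ih x xs => //; exact: ltW.
Qed.

Lemma phase_max_mem sigma E : phase_max sigma E \in phases sigma E.
Proof.
rewrite /phase_max; case: (phases sigma E) (phases_neq0 sigma E) => //= a s _.
exact: mem_head.
Qed.

Lemma phase_min_mem sigma E : phase_min sigma E \in phases sigma E.
Proof.
rewrite /phase_min; case: (phases sigma E) (phases_neq0 sigma E) => //= a s _.
exact: mem_last.
Qed.

(** The gap makes the phases of the concatenated tower decrease, so uniqueness identifies it with
    the HN filtration. *)
Lemma HN_data_cat sigma (E' E G : nzobj D) (f : hom (sval E') (sval E))
    (g : hom (sval E) (sval G)) (h : hom (sval G) (sh (sval E'))) :
  dist f g h -> phase_max sigma G < phase_min sigma E' ->
  HN_data sigma E = HN_data sigma E' ++ HN_data sigma G.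
Proof.
move=> d lt; have [towE' srtE'] := HN_is_HN sigma E'.
have [towG srtG] := HN_is_HN sigma G.
rewrite /HN_data /hn_data -map_cat -/(hn_data _); apply: HN_data_eq.
split; first exact: (hn_tower_cat towE' d towG).
rewrite map_cat; move: lt srtE' srtG (phases_neq0 sigma E') (phases_neq0 sigma G).
rewrite /phase_max /phase_min -/(phases sigma E') -/(phases sigma G).
case: (phases sigma E') => // a s; case: (phases sigma G) => //= b t lt srt1 srt2 _ _.
by rewrite cat_path srt1 /= lt.
Qed.

Lemma HN_data_semistable sigma E phi : slice sigma phi (sval E) ->
  HN_data sigma E = [:: (phi, K0_class (sval E))].
Proof.
move=> PE; apply: (HN_data_eq (s := [:: (phi, sval E)])); split=> //.
exact: hn_tower1 PE (svalP E).
Qed.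

Lemma phases_semistable sigma E phi :
  phases sigma E = [:: phi] -> slice sigma phi (sval E).
Proof.
have [tow _] := HN_is_HN sigma E; rewrite /phases.
case: (HN sigma E) tow => [|[psi G] [|? ?]] //= tow [epsi].
by rewrite -epsi; exact: hn_tower_seq1 (stab_slicing sigma) _ _ _ tow.
Qed.

Lemma phase_eq_semistable sigma E phi : phase_max sigma E = phi ->
  phase_min sigma E = phi -> slice sigma phi (sval E).
Proof.
move=> emax emin; apply: phases_semistable; move: emax emin (phases_neq0 sigma E).
rewrite /phase_max /phase_min; have := phases_sorted sigma E.
case: (phases sigma E) => [//|a [|b s]] /= srt ea emin _; first by rewrite ea.
rewrite {}ea in srt; have {}srt : path >%R phi (b :: s) := srt.
(* With two or more phases, strict decrease puts the last below the first. *)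
have : phi < phi; last by rewrite ltxx.
rewrite -[X in X < _]emin.
have /allP := order_path_min (rev_trans lt_trans) srt.
by rewrite -emin; apply; rewrite mem_last.
Qed.

(** The integral of [h] against the mass measure of [E]. *)
Definition mass_integral sigma (h : R -> R) E : R :=
  \sum_(x <- HN_data sigma E) cabs (charge sigma x.2) * h x.1.

Lemma mass_data sigma E :
  mass sigma E = \sum_(x <- HN_data sigma E) cabs (charge sigma x.2).
Proof. by rewrite /mass big_map. Qed.

Lemma mass_semistable sigma E phi : slice sigma phi (sval E) ->
  mass sigma E = cabs (charge sigma (K0_class (sval E))).
Proof. by move=> /HN_data_semistable e; rewrite mass_data e big_seq1. Qed.

(** The support property bounds the charge below by a multiple of the norm of the lattice class, and
    nonzero norms of lattice elements are bounded away from 0. *)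
Lemma support_bound sigma : finite_positive_rank L ->
  exists2 c : R, 0 < c & forall phi (E : D), slice sigma phi E ->
    ~ is_zero_obj E -> c <= cabs (charge sigma (K0_class E)).
Proof.
move=> L_rank; have [_ [N normN inf0]] := stab_support sigma.
have [c c0 cN] := norm_lattice_bound L_rank normN.
have [N_ge0 _ _ _] := normN.
set S := [set y | _] in inf0.
have [d d0 dS] : exists2 d : R, 0 < d & forall y, S y -> (d%:E <= y)%E.
  have lb y : S y -> (ereal_inf S <= y)%E by exact: ereal_inf_lbound.
  case: (ereal_inf S) inf0 lb => [r|_ lb|//].
    by rewrite lte_fin => r0 lb; exists r.
  (* Here the infimum is +oo, so any constant is a lower bound. *)
  by exists 1 => // y /lb; apply: le_trans; rewrite leey.
exists (d * c); first exact: mulr_gt0.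
move=> phi E PE nzE.
have := dS _ (ex_intro _ phi (ex_intro _ E (And3 PE nzE erefl))).
rewrite lee_fin; set Nv := N _; set z := cabs _ => dz.
(* A zero norm would make the ratio 0, since [invr0] sets the inverse of 0 to 0, against the
   positive infimum. *)
have Nv0 : Nv != 0.
  by apply: contraTneq dz => ->; rewrite invr0 mulr0 -ltNge.
have Nv1 : 0 < Nv by rewrite lt_neqAle eq_sym Nv0 N_ge0.
by move: dz; rewrite ler_pdivlMr//; apply: le_trans; rewrite ler_pM2l// cN.
Qed.

Lemma mass_bound sigma : finite_positive_rank L ->
  exists2 c : R, 0 < c & forall E, c <= mass sigma E.
Proof.
move=> /(support_bound sigma)[c c0 hc]; exists c => // E.
have [tow _] := HN_is_HN sigma E; rewrite /mass; move: (HN sigma E) tow => s.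
case: E => E nzE /= tow; case: tow nzE => // E' F G phi {}s f g h _ _ PG nzG _.
rewrite big_rcons/= (le_trans (hc _ _ PG nzG))// lerDr.
by apply: sumr_ge0 => x _; exact: cabs_ge0.
Qed.

Lemma mass_gt0 sigma E : 0 < mass sigma E.
Proof.
have := HN_weights_gt0 sigma E; have := HN_weights_neq0 sigma E.
rewrite /mass /HN_weights; case: (HN sigma E) => //= x s _ /andP[x0 _].
by rewrite big_cons ltr_wpDr// sumr_ge0// => y _; exact: cabs_ge0.
Qed.

(** * Comparison of stability conditions at small distance *)

Section Distance.
Variables (sigma tau : Stab R v) (e : R).
Hypothesis lt_e : (stab_dist sigma tau < e%:E)%E.

Let bound (y : R) (E : nzobj D) :
  [\/ y = `|phase_max sigma E - phase_max tau E|,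
      y = `|phase_min sigma E - phase_min tau E| |
      y = `|ln (mass tau E / mass sigma E)|] -> y < e.
Proof.
move=> h; rewrite -lte_fin; apply: le_lt_trans lt_e.
apply: ereal_sup_ubound; exists E.
by case: h => ->; [constructor 1|constructor 2|constructor 3].
Qed.

Lemma phase_max_close E : `|phase_max sigma E - phase_max tau E| < e.
Proof. by apply: (@bound _ E); constructor 1. Qed.

Lemma phase_min_close E : `|phase_min sigma E - phase_min tau E| < e.
Proof. by apply: (@bound _ E); constructor 2. Qed.

Lemma ln_mass_close E : `|ln (mass tau E) - ln (mass sigma E)| < e.
Proof.
rewrite -ln_div ?posrE ?mass_gt0//.
by apply: (@bound _ E); constructor 3.
Qed.

Lemma mass_lt_expR E : mass tau E < expR e * mass sigma E.
Proof.
have := ln_mass_close E; rewrite ltr_norml => /andP[_].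
rewrite ltrBlDr => lt_ln; rewrite -[ltLHS]lnK ?posrE ?mass_gt0//.
by rewrite -[mass _ _ in ltRHS]lnK ?posrE ?mass_gt0// -expRD ltr_expR.
Qed.

Lemma mass_gt_expR E : mass sigma E < expR e * mass tau E.
Proof.
have := ln_mass_close E; rewrite distrC ltr_norml => /andP[_].
rewrite ltrBlDr => lt_ln; rewrite -[ltLHS]lnK ?posrE ?mass_gt0//.
by rewrite -[mass _ _ in ltRHS]lnK ?posrE ?mass_gt0// -expRD ltr_expR.
Qed.

End Distance.

(* A tau-semistable H has weight |Z_tau(H)| = m_tau(H) > m_sigma(H) / e. *)
Lemma weight_bound sigma : finite_positive_rank L ->
  exists2 c : R, 0 < c & forall tau, (stab_dist sigma tau < 1%:E)%E ->
    forall E, all (fun x => c <= cabs (charge tau (K0_class x.2))) (HN tau E).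
Proof.
move=> /(mass_bound sigma)[c c0 hc].
exists ((expR 1)^-1 * c); first by rewrite mulr_gt0// invr_gt0 expR_gt0.
move=> tau lt1 E; have [tow _] := HN_is_HN tau E; elim: tow => // {E}.
move=> E' E G phi s f g h _ ih _ PG nzG.
rewrite all_rcons ih andbT /= ler_pdivrMl ?expR_gt0//.
have := mass_gt_expR lt1 (exist (fun A : D => ~ is_zero_obj A) G nzG).
by rewrite (mass_semistable (sigma := tau) (phi := phi))// => /ltW; exact: le_trans.
Qed.

Lemma eq_weighted_sum sigma (h : R -> R) E :
  \sum_(y <- HN_weights sigma E) y.2%:num * h y.1 = mass_integral sigma h E.
Proof. by rewrite /mass_integral !big_map. Qed.

Lemma HN_weights_fst sigma E : [seq y.1 | y <- HN_weights sigma E] = phases sigma E.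
Proof. by rewrite /HN_weights -map_comp. Qed.

(* The triangle inequality, which would identify this filter with the
   neighbourhoods of sigma, is never needed. *)
Definition stab_balls sigma : set_system (Stab R v) :=
  [set A | exists2 e : R, 0 < e &
     forall tau, (stab_dist sigma tau < e%:E)%E -> A tau].

Global Instance stab_balls_filter sigma : Filter (stab_balls sigma).
Proof.
split; first by exists 1.
  move=> A B [e e0 eA] [d d0 dB]; exists (Num.min e d); first by rewrite lt_min e0.
  by move=> tau; rewrite EFin_min lt_min => /andP[/eA ? /dB].
by move=> A B AB [e e0 eA]; exists e => // tau /eA /AB.
Qed.

Lemma stab_ballsP sigma (e : R) : 0 < e ->
  \forall tau \near stab_balls sigma, (stab_dist sigma tau < e%:E)%E.
Proof. by move=> e0; exists e. Qed.

Lemma ln_mass_cvg sigma E :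
  ln (mass tau E) @[tau --> stab_balls sigma] --> ln (mass sigma E).
Proof.
apply/cvgrPdist_lt => e e0; near=> tau.
rewrite distrC; apply: ln_mass_close; near: tau; exact: stab_ballsP.
Unshelve. all: by end_near. Qed.

Lemma mass_cvg sigma E :
  mass tau E @[tau --> stab_balls sigma] --> mass sigma E.
Proof.
have -> : (fun tau => mass tau E) = fun tau => expR (ln (mass tau E)).
  by apply/funext => tau; rewrite lnK// posrE mass_gt0.
have : expR @ ln (mass sigma E) --> expR (ln (mass sigma E)).
  exact: continuous_expR.
rewrite lnK ?posrE ?mass_gt0// => cvg_exp.
by apply: cvg_comp cvg_exp; exact: ln_mass_cvg.
Qed.

(** All tau-phases of [E] are close to [phi], so its integral is the tau-mass times [h phi], up to
    the oscillation of [h] near [phi] weighted by the mass. *)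
Lemma mass_integral_semistable_cvg sigma (h : R -> R) E phi :
  continuous h -> slice sigma phi (sval E) ->
  mass_integral tau h E @[tau --> stab_balls sigma] --> mass_integral sigma h E.
Proof.
move=> ch PE.
have maxE : phase_max sigma E = phi.
  by rewrite /phase_max phases_data (HN_data_semistable PE).
have minE : phase_min sigma E = phi.
  by rewrite /phase_min phases_data (HN_data_semistable PE).
have -> : mass_integral sigma h E = mass sigma E * h phi + 0.
  by rewrite /mass_integral mass_data (HN_data_semistable PE) !big_seq1 addr0.
have -> : (fun tau => mass_integral tau h E) = (fun tau => mass tau E * h phi +
    (mass_integral tau (fun x => h x - h phi) E)).
  apply/funext => tau; rewrite /mass_integral mass_data mulr_suml -big_split/=.
  by apply: eq_bigr => x _; rewrite mulrBr addrC subrK.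
apply: cvgD; first by apply: cvgMl; exact: mass_cvg.
apply/cvgrPdist_lt => eta eta0.
have M0 : 0 < expR 1 * mass sigma E by rewrite mulr_gt0 ?expR_gt0 ?mass_gt0.
(* At distance below 1 the tau-mass stays under [expR 1 * mass sigma E], which fixes the tolerance
   on [h]. *)
have /cvgrPdist_lt/(_ (eta / (expR 1 * mass sigma E))) := ch phi.
rewrite divr_gt0// => /(_ isT)/nbhs_ballP[e /= e0 he].
near=> tau.
have lt1 : (stab_dist sigma tau < 1%:E)%E by near: tau; exact: stab_ballsP.
have lte : (stab_dist sigma tau < e%:E)%E by near: tau; exact: stab_ballsP.
rewrite sub0r normrN (le_lt_trans (ler_norm_sum _ _ _))//.
apply: (@le_lt_trans _ _ (mass tau E * (eta / (expR 1 * mass sigma E)))); last first.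
  rewrite mulrCA gtr_pMr// ltr_pdivrMr// mul1r.
  exact: mass_lt_expR.
rewrite mass_data mulr_suml !big_seq; apply: ler_sum => x xE.
rewrite normrM (ger0_norm (cabs_ge0 _)) ler_wpM2l ?cabs_ge0// distrC ltW//.
apply: he; rewrite /ball /=.
have /phases_bounds/andP[] : x.1 \in phases tau E.
  by rewrite phases_data map_f.
have := phase_max_close lte E; have := phase_min_close lte E.
rewrite maxE minE !ltr_norml => /andP[_ h2] /andP[h3 _] h4 h5.
by apply/andP; split; lra.
Unshelve. all: by end_near. Qed.

Lemma mass_integral_cat sigma (h : R -> R) (E' E G : nzobj D) :
  HN_data sigma E = HN_data sigma E' ++ HN_data sigma G ->
  mass_integral sigma h E = mass_integral sigma h E' + mass_integral sigma h G.
Proof. by move=> e; rewrite /mass_integral e big_cat. Qed.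

(** Induction on the sigma-tower: for tau close to sigma the phase gap between [E'] and [G]
    persists, so the integral is the sum of those of [E'] and the semistable [G]. *)
Lemma mass_integral_cvg sigma (h : R -> R) E : continuous h ->
  mass_integral tau h E @[tau --> stab_balls sigma] --> mass_integral sigma h E.
Proof.
move=> ch; have [tow srt] := HN_is_HN sigma E.
case: E tow srt => E nzE; move: (HN _ _) => s /= tow.
elim: tow nzE => // {E s} E' E G phi s f g h' tow ih d PG nzG nzE.
rewrite sorted_gt_rcons => /andP[al srt].
pose GG : nzobj D := exist _ G nzG; pose EE : nzobj D := exist _ E nzE.
have cvgG : mass_integral tau h GG @[tau --> stab_balls sigma] -->
    mass_integral sigma h GG.
  exact: (mass_integral_semistable_cvg (E := GG) ch PG).
have [zE'|nzE'] := pselect (is_zero_obj E').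
  have eqE tau : mass_integral tau h EE = mass_integral tau h GG.
    rewrite /mass_integral (HN_data_iso tau (E := EE) (G := GG))//=.
    exact: dist_isor d zE'.
  rewrite -/EE eqE; apply: cvg_trans cvgG; apply: near_eq_cvg.
  by apply: nearW => tau; rewrite eqE.
pose EE' : nzobj D := exist _ E' nzE'.
have maxG : phase_max sigma GG = phi.
  by rewrite /phase_max phases_data (HN_data_semistable (E := GG) PG).
have minE' : phi < phase_min sigma EE'.
  have eqs : phases sigma EE' = [seq x.1 | x <- s].
    by rewrite phases_data (HN_data_eq (E := EE') (conj tow srt)) -map_comp.
  have := phase_min_mem sigma EE'; rewrite {}eqs.
  by apply/allP: (phase_min _ _); rewrite all_map.
(* Two phases that each move by less than half the gap stay in order. *)
have gap : 0 < (phase_min sigma EE' - phi) / 2 by rewrite divr_gt0// subr_gt0.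
rewrite -/EE (mass_integral_cat h (E' := EE') (G := GG)); last first.
  by apply: (HN_data_cat (E' := EE') (E := EE) (G := GG) d); rewrite maxG.
apply: cvg_trans (cvgD (ih nzE' srt) cvgG); apply: near_eq_cvg.
near=> tau; apply/esym/mass_integral_cat.
apply: (HN_data_cat (E' := EE') (E := EE) (G := GG) d).
have lt : (stab_dist sigma tau < ((phase_min sigma EE' - phi) / 2)%:E)%E.
  by near: tau; exact: stab_ballsP.
have := phase_max_close lt GG; have := phase_min_close lt EE'.
rewrite maxG !ltr_norml => /andP[_ h1] /andP[h2 _]; lra.
Unshelve. all: by end_near. Qed.

End StabilityConditions.

(** * Finitely supported measures *)

Section Convergence.

Lemma cvg_initial_topology (S : choiceType) (T : topologicalType) (f : S -> T)
    (F : set_system S) (s : S) :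
  Filter F -> f @ F --> f s -> F --> (s : initial_topology f).
Proof.
move=> FF Ff U [_ [[W oW <-]] /= Wfs] /filterS; apply; apply: Ff.
exact: open_nbhs_nbhs.
Qed.

Lemma cvg_prod_topology (I : Type) (K : I -> topologicalType)
    (F : set_system (prod_topology K)) (f : prod_topology K) :
  Filter F -> (forall i, proj i @ F --> f i) -> F --> f.
Proof.
move=> FF Ff; apply/cvg_sup => i.
exact: (@cvg_initial_topology _ _ (fun g : prod_topology K => g i)).
Qed.

End Convergence.

Section WeightedSums.
Variable R : realType.
Implicit Types (s t : seq (R * {nonneg R})) (f h : R -> R).

Lemma polynomial_interpolation (F : fieldType) (f : F -> F) (s : seq F) :
  exists q : {poly F}, forall x, x \in s -> q.[x] = f x.
Proof.
elim: s => [|a s [q qf]]; first by exists 0.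
have [as_|as_] := boolP (a \in s).
  by exists q => x; rewrite inE => /predU1P[->|]; exact: qf.
pose B : {poly F} := \prod_(b <- s) ('X - b%:P).
have Ba : B.[a] != 0 by rewrite -[_ == 0]/(root B a) root_prod_XsubC.
exists (q + ((f a - q.[a]) / B.[a]) *: B) => x; rewrite hornerD hornerZ inE.
move=> /predU1P[->|xs]; first by rewrite divfK// addrC subrK.
by have /rootP -> : root B x; rewrite ?root_prod_XsubC// mulr0 addr0 qf.
Qed.

(** Any function agrees with a polynomial on the finitely many points involved, so polynomial
    moments determine all integrals, in particular those of indicators. *)
Lemma weighted_sum_poly s t :
  (forall q : {poly R}, \sum_(x <- s) x.2%:num * q.[x.1] =
                        \sum_(x <- t) x.2%:num * q.[x.1]) ->
  forall f, \sum_(x <- s) x.2%:num * f x.1 = \sum_(x <- t) x.2%:num * f x.1.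
Proof.
move=> st f; have [q qf] := polynomial_interpolation f [seq x.1 | x <- s ++ t].
have eqf u : {subset u <= s ++ t} ->
    \sum_(x <- u) x.2%:num * f x.1 = \sum_(x <- u) x.2%:num * q.[x.1].
  move=> ust; rewrite !big_seq; apply: eq_bigr => x xu.
  by rewrite qf// map_f// ust.
rewrite !eqf ?st// => x xu; rewrite mem_cat xu ?orbT//.
Qed.

Lemma dirac_comb_fin s (A : set R) :
  dirac_comb s A = (\sum_(x <- s) x.2%:num * \1_A x.1)%:E.
Proof.
rewrite dirac_combE -sumEFin; apply: eq_bigr => x _.
by rewrite diracE indicE EFinM.
Qed.

Lemma dirac_comb_eq s t :
  (forall q : {poly R}, \sum_(x <- s) x.2%:num * q.[x.1] =
                        \sum_(x <- t) x.2%:num * q.[x.1]) ->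
  dirac_comb s = dirac_comb t.
Proof.
move=> /weighted_sum_poly st; apply: eq_measure; apply/funext => A.
by rewrite !dirac_comb_fin st.
Qed.

Lemma fsmeasure_eq (mu nu : fsmeasure R) : sval mu = sval nu -> mu = nu.
Proof. by case: mu nu => [mu ?] [nu ?] /= e; exact: eq_exist. Qed.

Section Points.
Variable d : nat.
Implicit Type x : weighted_points R d.

Lemma big_points_seq x h :
  \sum_(y <- points_seq x) y.2%:num * h y.1 =
  \sum_(i < d) set_val (x.2 i) * h (x.1 i).
Proof. by rewrite big_map big_enum. Qed.

Lemma weight_continuous (i : 'I_d) :
  continuous (fun x : weighted_points R d => set_val (x.2 i) : R).
Proof.
pose K (_ : 'I_d) : topologicalType := set_type (@pos_reals R).
have c1 : continuous (fun x : weighted_points R d => x.2 : prod_topology K).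
  by move=> x; exact: cvg_snd.
have c2 : continuous (fun f : prod_topology K => f i).
  exact: (@proj_continuous 'I_d K i).
have c3 : continuous (set_val : set_type (@pos_reals R) -> R).
  exact: initial_continuous.
by move=> x U /(c3 (x.2 i)) /(c2 x.2) /(c1 x).
Qed.

Lemma point_continuous (i : 'I_d) :
  continuous (fun x : weighted_points R d => x.1 i : R).
Proof.
pose K (_ : 'I_d) : topologicalType := R.
have c1 : continuous (fun x : weighted_points R d => x.1 : prod_topology K).
  by move=> x; exact: cvg_fst.
have c2 : continuous (fun f : prod_topology K => f i).
  exact: (@proj_continuous 'I_d K i).
by move=> x U /(c2 x.1) /(c1 x).
Qed.

Lemma weighted_sum_continuous h : continuous h ->
  continuous (fun x => \sum_(y <- points_seq x) y.2%:num * h y.1).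
Proof.
move=> ch.
have -> : (fun x => \sum_(y <- points_seq x) y.2%:num * h y.1) =
    (fun x : weighted_points R d => \sum_(i < d) set_val (x.2 i) * h (x.1 i)).
  by apply/funext => y; rewrite big_points_seq.
apply: (@continuous_big R 'I_d +%R 0 xpredT add_continuous
  (weighted_points R d) (index_enum _)
  (fun i x => set_val (x.2 i) * h (x.1 i))) => i _ x.
have ch1 : continuous (fun x : weighted_points R d => h (x.1 i)).
  by move=> y U /(ch (y.1 i)) /(@point_continuous i y).
exact: (cvgM (@weight_continuous i x) (ch1 x)).
Qed.

(** The truncation [Num.max t a] stays in the positive reals and exhibits the set as a continuous
    image of the segment from [a] to [b]. *)
Lemma compact_pos_reals (a b : R) : 0 < a ->
  compact [set t : set_type (@pos_reals R) | a <= set_val t <= b].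
Proof.
move=> a0.
have pos (t : R) : Num.max t a \in @pos_reals R.
  by rewrite inE /pos_reals /= lt_max a0 orbT.
pose phi (t : R) : set_type (@pos_reals R) := exist _ (Num.max t a) (pos t).
have cphi : continuous phi.
  apply: continuous_comp_initial => t.
  by apply: continuous_max; [exact: cvg_id|exact: cvg_cst].
have -> : [set t : set_type (@pos_reals R) | a <= set_val t <= b] =
    phi @` `[a, b].
  apply/seteqP; split=> [t /= tab|_ [t + <-]].
    exists (set_val t); first by rewrite in_itv.
    by apply/val_inj; rewrite /= max_l//; case/andP: tab.
  by rewrite /= in_itv/= => /andP[at_ tb]; rewrite set_valE/= max_l// at_.
apply: continuous_compact; last exact: segment_compact.
exact: continuous_subspaceT.
Qed.

Lemma compact_points_box (l u a b : R) : 0 < a -> compact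
  [set x : weighted_points R d | (forall i, l <= x.1 i <= u) /\
    (forall i, a <= set_val (x.2 i) <= b)].
Proof.
move=> a0.
have c1 := @tychonoff 'I_d (fun _ => R) (fun _ => [set x : R | l <= x <= u]).
have c2 := @tychonoff 'I_d (fun _ => set_type (@pos_reals R))
  (fun _ => [set t | a <= set_val t <= b]).
apply: (compact_setX (c1 _) (c2 _)) => i; last exact: compact_pos_reals.
by have := @segment_compact R l u; rewrite set_itvcc.
Qed.

Lemma points_seq_surj s : size s = d -> all (fun y => 0 < y.2%:num) s ->
  exists x : weighted_points R d, points_seq x = s.
Proof.
move=> sz s0; have x0 : R * {nonneg R} by exact: (0, 0%:nng).
have pos (i : 'I_d) : (nth x0 s i).2%:num \in @pos_reals R.
  by rewrite inE; apply: (allP s0); rewrite mem_nth// sz.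
pose w (i : 'I_d) : set_type (@pos_reals R) :=
  exist (fun r => r \in @pos_reals R) _ (pos i).
exists ((fun i : 'I_d => (nth x0 s i).1, w) : weighted_points R d).
apply: (@eq_from_nth _ x0); first by rewrite size_map size_enum_ord sz.
move=> i; rewrite size_map size_enum_ord => id.
rewrite (nth_map (Ordinal id)) ?size_enum_ord//.
rewrite (nth_ord_enum (Ordinal id) (Ordinal id)) [RHS]surjective_pairing.
by congr pair; exact/val_inj.
Qed.

End Points.

Lemma open_strong_fsmeasure (U : set (fsmeasure R)) :
  open (U : set (strong_fsmeasure R)) ->
  forall d, open (@points_measure R d @^-1` U).
Proof. by move=> oU d; exact: (oU d tt). Qed.

End WeightedSums.

(** * The mass measure *)

Section MassMeasure.
Variables (R : realType) (k : fieldType) (D : triCat k) (L : zmodType)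
  (v : {additive K0 D -> L}).
Implicit Types (sigma tau : Stab R v) (E : nzobj D).

Lemma meas_mass_mass_measure sigma E : meas_mass (mass_measure sigma E) = mass sigma E.
Proof.
rewrite /meas_mass /= dirac_comb_fin /= big_map /mass.
by apply: eq_bigr => x _; rewrite /= indicE in_setT mulr1.
Qed.

Lemma supp_mass_measure sigma E :
  supp (mass_measure sigma E) = [set x | x \in phases sigma E].
Proof.
apply/seteqP; split=> x; rewrite /supp /= dirac_comb_fin -HN_weights_fst.
  rewrite eqe; apply: contraNP => /negP xE; rewrite big_seq big1// => y yE.
  rewrite indicE memNset ?mulr0//= => yx; move/negP : xE; apply.
  by rewrite -yx map_f.
move=> /mapP[y yE ->]; rewrite eqe gt_eqF// (perm_big _ (perm_to_rem yE))/= big_cons.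
rewrite indicE in_set1 eqxx mulr1 ltr_wpDr//.
  by apply: sumr_ge0 => z _; rewrite mulr_ge0// indicE.
by have /allP := HN_weights_gt0 sigma E; exact.
Qed.

Lemma meas_max_mass_measure sigma E :
  meas_max (mass_measure sigma E) = phase_max sigma E.
Proof.
rewrite /meas_max supp_mass_measure; apply/eqP; rewrite eq_le; apply/andP; split.
  apply: ge_sup; first by exists (phase_max sigma E); exact: phase_max_mem.
  by move=> x /phases_bounds/andP[].
apply: ub_le_sup; last exact: phase_max_mem.
by exists (phase_max sigma E) => x /phases_bounds/andP[].
Qed.

Lemma meas_min_mass_measure sigma E :
  meas_min (mass_measure sigma E) = phase_min sigma E.
Proof.
rewrite /meas_min supp_mass_measure; apply/eqP; rewrite eq_le; apply/andP; split.
  apply: ge_inf; last exact: phase_min_mem.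
  by exists (phase_min sigma E) => x /phases_bounds/andP[].
apply: lb_le_inf; first by exists (phase_min sigma E); exact: phase_min_mem.
by move=> x /phases_bounds/andP[].
Qed.

Lemma meas_coords_mass_measure sigma E : meas_coords (mass_measure sigma E) =
  (ln (mass sigma E), phase_max sigma E, phase_min sigma E).
Proof.
by rewrite /meas_coords meas_mass_mass_measure meas_max_mass_measure
  meas_min_mass_measure.
Qed.

Lemma points_measure_mass_measure sigma E d (x : weighted_points R d.+1) :
  (forall q : {poly R}, \sum_(y <- points_seq x) y.2%:num * q.[y.1] =
     mass_integral sigma (horner q) E) ->
  points_measure x = mass_measure sigma E.
Proof.
move=> xE; apply: fsmeasure_eq; apply: dirac_comb_eq => q.
by rewrite xE -eq_weighted_sum.
Qed.

(** Otherwise the neighbourhoods of [f x] and [l] of radius half their distance would have to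
    meet. *)
Lemma cvg_cluster_eq (T : topologicalType) (F : set_system T) (f : T -> R)
    (l : R) (x : T) :
  continuous f -> f @ F --> l -> cluster F x -> f x = l.
Proof.
move=> cf Fl Fx; apply/eqP; rewrite -subr_eq0 -normr_eq0.
apply: contrapT => /negP neq0; have e0 : 0 < `|f x - l| / 2.
  by rewrite divr_gt0// lt_neqAle eq_sym neq0 normr_ge0.
have /= F1 : F [set y | `|l - f y| < `|f x - l| / 2].
  by have := Fl _ (nbhsx_ballx l _ e0).
have /= N1 : nbhs x [set y | `|f x - f y| < `|f x - l| / 2].
  by have := cf x _ (nbhsx_ballx (f x) _ e0).
have [y [/= ly xy]] := Fx _ _ F1 N1.
have : `|f x - l| <= `|f x - f y| + `|l - f y|.
  by rewrite (distrC l) (le_trans _ (ler_normD _ _))// addrA subrK.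
by lra.
Qed.

(* With the number of points fixed, the nearby Harder-Narasimhan data lie in a
   compact box, and all their polynomial moments converge; so every cluster
   point represents the limit measure. *)
Lemma mass_measure_near_size sigma E (U : set (fsmeasure R)) d :
  finite_positive_rank L -> open (U : set (strong_fsmeasure R)) ->
  U (mass_measure sigma E) ->
  \forall tau \near stab_balls sigma,
    size (HN tau E) = d.+1 -> U (mass_measure tau E).
Proof.
move=> L_rank oU UE.
(* [F] collects what holds eventually for parametrizations of mass measures outside [U]. If it
   contains the empty set, no such measure occurs near sigma; otherwise it has a cluster point in a
   compact box. *)
pose F : set_system (weighted_points R d.+1) := [set W |
  \forall tau \near stab_balls sigma, forall x : weighted_points R d.+1,
    points_seq x = HN_weights tau E -> ~ U (points_measure x) -> W x].
have FF : Filter F.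
  split; first by apply: nearW.
    move=> A B FA FB; rewrite /F /=; near=> tau => x xE nU; split.
      by move: x xE nU; near: tau.
    by move: x xE nU; near: tau.
  move=> A B AB; rewrite /F /=; apply: filterS => tau h x xE nU.
  by apply: AB; exact: h.
have [F0|F0] := pselect (F set0).
  move: F0; rewrite /F /=; apply: filterS => tau h sz.
  apply: contrapT => nU.
  have [x xE] : exists x : weighted_points R d.+1, points_seq x = HN_weights tau E.
    by apply: points_seq_surj (HN_weights_gt0 _ _); rewrite size_map.
  apply: (h x xE); suff -> : points_measure x = mass_measure tau E by [].
  by apply: fsmeasure_eq; rewrite /= xE.
have PF : ProperFilter F by exact: Build_ProperFilter.
have [c c0 cE] := weight_bound sigma L_rank.
(* Distance below 1 moves the extreme phases by less than 1 and the mass by a factor less than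
   [expR 1], which bounds every single weight above. *)
have [|x [_ Fx]] := @compact_points_box R d.+1 (phase_min sigma E - 1)
    (phase_max sigma E + 1) c (expR 1 * mass sigma E) c0 F PF.
  rewrite /F /=; near=> tau => x xE _.
  have lt1 : (stab_dist sigma tau < 1%:E)%E by near: tau; exact: stab_ballsP.
  have x1 i : x.1 i \in phases tau E.
    rewrite -HN_weights_fst -xE -map_comp.
    by apply/mapP; exists i; rewrite ?mem_enum.
  have x2 i : c <= set_val (x.2 i) <= mass tau E.
    have := cE _ lt1 E.
    have -> : mass tau E = \sum_(y <- points_seq x) y.2%:num by rewrite xE big_map.
    have -> : all (fun y => c <= cabs (charge tau (K0_class y.2))) (HN tau E) =
        all (fun y : R * {nonneg R} => c <= y.2%:num) (points_seq x).
      by rewrite xE all_map.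
    rewrite big_map big_enum all_map => /allP/(_ i (mem_enum _ _)) /= ->.
    rewrite (bigD1 i)//= lerDl sumr_ge0// => j _.
    exact: pos_reals_ge0.
  split=> i.
    have /andP[xmin xmax] := phases_bounds (x1 i).
    have := phase_max_close lt1 E; have := phase_min_close lt1 E.
    rewrite !ltr_norml => /andP[_ h1] /andP[h2 _]; apply/andP; split; lra.
  have /andP[-> xm] := x2 i; rewrite (le_trans xm)// ltW//.
  exact: mass_lt_expR.
have xE : points_measure x = mass_measure sigma E.
  apply: points_measure_mass_measure => q.
  have cq : continuous (horner q) by exact: continuous_horner.
  apply: (cvg_cluster_eq (weighted_sum_continuous cq) _ Fx).
  move=> A /(mass_integral_cvg (sigma := sigma) (E := E) cq) NA.
  have {}NA : \forall tau \near stab_balls sigma,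
    A (mass_integral tau (horner q) E) by exact: NA.
  change (F [set y | A (\sum_(z <- points_seq y) z.2%:num * q.[z.1])]).
  rewrite /F /=; near=> tau => y yE _.
  by rewrite yE eq_weighted_sum; near: tau.
(* The cluster point lies in the open preimage of [U], while [F] contains the complement of that
   preimage. *)
have [y [/= nUy Uy]] : [set x : weighted_points R d.+1 | ~ U (points_measure x)] `&`
    (@points_measure R d @^-1` U) !=set0.
  apply: Fx; first by rewrite /F /=; apply: nearW.
  apply: open_nbhs_nbhs; split; first exact: open_strong_fsmeasure.
  by rewrite /= xE.
by [].
Unshelve. all: by end_near. Qed.

(** Each HN factor contributes at least [c] to a mass below [expR 1 * mass sigma E]. *)
Lemma HN_size_bound sigma E : finite_positive_rank L ->
  exists n : nat, \forall tau \near stab_balls sigma, (size (HN tau E) <= n)%N.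
Proof.
move=> /(weight_bound sigma)[c c0 cE].
exists (Num.truncn (expR 1 * mass sigma E / c)); near=> tau.
have lt1 : (stab_dist sigma tau < 1%:E)%E by near: tau; exact: stab_ballsP.
rewrite truncn_ge_nat; last first.
  by rewrite divr_ge0 ?mulr_ge0 ?expR_ge0 ?ltW ?mass_gt0.
rewrite ler_pdivlMr// (le_trans _ (ltW (mass_lt_expR lt1 E)))// /mass.
have := cE _ lt1 E; elim: (HN tau E) => [|x s ih] /=.
  by rewrite mul0r big_nil.
by move=> /andP[cx /ih cs]; rewrite big_cons -natr1 mulrDl mul1r addrC lerD.
Unshelve. all: by end_near. Qed.

Lemma mass_measure_cvg sigma E : finite_positive_rank L ->
  (mass_measure tau E : strong_fsmeasure R) @[tau --> stab_balls sigma] -->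
    (mass_measure sigma E : strong_fsmeasure R).
Proof.
move=> L_rank A; rewrite nbhsE => -[U [oU UE] UA].
have [n size_n] := HN_size_bound sigma E L_rank.
(* Only finitely many sizes occur, so the neighbourhoods for each can be intersected; [d] stands for
   size [d.+1]. *)
have near_n : \forall tau \near stab_balls sigma, forall d : 'I_n,
    size (HN tau E) = d.+1 -> U (mass_measure tau E).
  by apply: filter_forall => d; exact: mass_measure_near_size.
rewrite /= nbhs_simpl /=; near=> tau; apply: UA.
have sz : (size (HN tau E) <= n)%N by near: tau.
have sz0 : (0 < size (HN tau E))%N.
  by have := HN_data_neq0 tau E; rewrite -size_eq0 size_map lt0n.
have lt_n : ((size (HN tau E)).-1 < n)%N by rewrite prednK.
have h : forall d : 'I_n, size (HN tau E) = d.+1 -> U (mass_measure tau E).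
  by near: tau.
by apply: (h (Ordinal lt_n)); rewrite /= prednK.
Unshelve. all: by end_near. Qed.

(** * The map on isomorphism classes, its injectivity and its inverse *)

Definition iso_class_of E : iso_class D :=
  exist _ [set F | isomorphic (sval E) F]
    (ex_intro _ (sval E) (conj (svalP E) erefl)).

Lemma class_repr_iso E : isomorphic (sval E) (sval (class_repr (iso_class_of E))).
Proof.
have [_ e] := svalP (cid (svalP (iso_class_of E))).
rewrite -[isomorphic _ _]/(sval (iso_class_of E) _) e /=.
exact: isomorphic_refl.
Qed.

Lemma dm_coords sigma E : meas_coords (dm sigma (iso_class_of E)) =
  (ln (mass sigma E), phase_max sigma E, phase_min sigma E).
Proof.
rewrite /dm meas_coords_mass_measure !mass_data /phase_max /phase_min !phases_data.
by rewrite -(HN_data_iso sigma (class_repr_iso E)).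
Qed.

Let coords sigma : {uniform iso_class D -> R * R * R} :=
  fun c => meas_coords (dm sigma c).

(** The distance on [Stab] is a supremum over all objects, so it controls the three coordinates
    uniformly in the class. *)
Lemma coords_cvg sigma : coords tau @[tau --> stab_balls sigma] --> coords sigma.
Proof.
move=> A /uniform_nbhs[W [+ WA]]; rewrite -entourage_ballE => -[e /= e0 eW].
change (\forall tau \near stab_balls sigma, A (coords tau)).
near=> tau; apply: WA => c _; apply: eW => /=.
have lt : (stab_dist sigma tau < e%:E)%E by near: tau; exact: stab_ballsP.
rewrite /coords /dm !meas_coords_mass_measure; split; first split.
- by rewrite /ball /= distrC; exact: ln_mass_close.
- by rewrite /ball /=; exact: phase_max_close.
- by rewrite /ball /=; exact: phase_min_close.
Unshelve. all: by end_near. Qed.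

Lemma dm_cvg sigma : finite_positive_rank L ->
  dm tau @[tau --> stab_balls sigma] --> dm sigma.
Proof.
move=> L_rank; apply: cvg_initial_topology.
have c1 : (dm tau : measure_family R D) @[tau --> stab_balls sigma] -->
    (dm sigma : measure_family R D).
  by apply: cvg_prod_topology => c; exact: mass_measure_cvg.
exact: (cvg_pair c1 (@coords_cvg sigma)).
Qed.

Lemma dm_continuous : finite_positive_rank L -> continuous (@dm R k D L v).
Proof.
move=> L_rank; apply/continuousP => A oA.
change (stab_open (@dm R k D L v @^-1` A)) => sigma /= Asigma.
have : nbhs (dm sigma) A by exact: open_nbhs_nbhs.
by move=> /(dm_cvg L_rank).
Qed.

Lemma stab_eq sigma tau : charge sigma = charge tau -> slice sigma = slice tau ->
  sigma = tau.
Proof.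
case: sigma tau => [Z P a b] [Z' P' a' b'] /= eZ eP.
by subst Z' P'; congr MkStab; exact: Prop_irrelevance.
Qed.

Lemma dm_injective : injective (@dm R k D L v).
Proof.
move=> sigma tau st.
have [em eM eI] : [/\ mass sigma =1 mass tau,
    phase_max sigma =1 phase_max tau & phase_min sigma =1 phase_min tau].
  split=> E; have := dm_coords sigma E; rewrite st dm_coords => -[e1 e2 e3] //.
  by rewrite -[LHS]lnK ?posrE ?mass_gt0// -e1 lnK ?posrE ?mass_gt0.
have slices sigma' tau' phi E : phase_max sigma' =1 phase_max tau' ->
    phase_min sigma' =1 phase_min tau' -> slice sigma' phi (sval E) ->
    slice tau' phi (sval E).
  move=> eM' eI' PE; apply: phase_eq_semistable.
    by rewrite -eM' /phase_max phases_data (HN_data_semistable PE).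
  by rewrite -eI' /phase_min phases_data (HN_data_semistable PE).
have eP : slice sigma = slice tau.
  apply/funext => phi; apply/seteqP; split=> E PE.
    have [zE|nzE] := pselect (is_zero_obj E).
      exact: slice_zero (stab_slicing tau) _ _ zE.
    by apply: (slices sigma tau phi (exist _ E nzE)).
  have [zE|nzE] := pselect (is_zero_obj E).
    exact: slice_zero (stab_slicing sigma) _ _ zE.
  by apply: (slices tau sigma phi (exist _ E nzE)) => // F; rewrite ?eM ?eI.
apply: stab_eq => //.
have [ZB _ Zpos] := stab_prestability sigma.
have [Z'B _ Z'pos] := stab_prestability tau.
have cabsE (r : R) phi : 0 < r ->
    cabs (r%:C * (cos (pi * phi) +i* sin (pi * phi)))%C = r.
  move=> r0; rewrite /cabs ComplexField.Normc.normcM /= expr0n /= addr0 sqrtr_sqr.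
  by rewrite cos2Dsin2 sqrtr1 mulr1 gtr0_norm.
(* Charges on the same ray are equal as soon as their moduli, here the masses, agree. *)
have eq_semistable phi G : slice sigma phi G -> ~ is_zero_obj G ->
    charge sigma (K0_class G) = charge tau (K0_class G).
  move=> PG nzG; have [r r0 rE] := Zpos _ _ PG nzG.
  have PG' : slice tau phi G by rewrite -eP.
  have [r' r'0 r'E] := Z'pos _ _ PG' nzG.
  have := em (exist _ G nzG).
  rewrite (mass_semistable (sigma := sigma) (E := exist _ G nzG) PG).
  rewrite (mass_semistable (sigma := tau) (E := exist _ G nzG) PG') /=.
  by rewrite rE r'E !cabsE// => ->.
(* Both charges are additive along the triangles of the sigma-HN tower. *)
have eq_class (E : D) : charge sigma (K0_class E) = charge tau (K0_class E).
  have [zE|nzE] := pselect (is_zero_obj E).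
    rewrite (K0_class_zero zE).
    by have := ZB 0 0; have := Z'B 0 0; rewrite !subrr => -> ->.
  have [tow _] := HN_is_HN sigma (exist _ E nzE).
  move: tow => /=; elim=> {nzE} [F zF|F' F G phi s f g h _ ih d PG nzG].
    rewrite (K0_class_zero zF).
    by have := ZB 0 0; have := Z'B 0 0; rewrite !subrr => -> ->.
  have additive_eq Z : zmod_morphism Z ->
      Z (K0_class F) = Z (K0_class F') + Z (K0_class G) :> R[i].
    by move=> ZA; apply/eqP; rewrite -subr_eq -ZA (K0_class_dist d) addrK.
  by rewrite !additive_eq// ih (eq_semistable phi).
apply/funext => u; have [x ->] := presented_class_surj u; move: x.
apply: free_ab_eq => [x y|x y|E]; last exact: eq_class.
  by rewrite presented_class_zmod_morphism ZB.
by rewrite presented_class_zmod_morphism Z'B.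
Qed.

(** The uniform coordinates alone suffice: closeness of all of them at [g y] and [g z] is closeness
    in [stab_dist]. *)
Lemma dm_inverse_continuous (g : set_type (range (@dm R k D L v)) -> Stab R v) :
  (forall y, dm (g y) = set_val y) -> continuous g.
Proof.
move=> gK y A; rewrite nbhsE => -[U [oU Uy] UA].
have [e e0 eU] := (oU : stab_open U) _ Uy.
(* The supremum of quantities below [e / 2] is only at most [e / 2], which is still below [e]. *)
have e2 : 0 < e / 2 by rewrite divr_gt0.
pose W : set (measure_family R D * {uniform iso_class D -> R * R * R}) :=
  [set p | forall c, ball (coords (g y) c) (e / 2) (p.2 c)].
have NW : nbhs (measure_family_coords (dm (g y))) W.
  exists (setT, [set h | forall c, ball (coords (g y) c) (e / 2) (h c)]);
    last by move=> p [_].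
  split; first exact: filterT.
  apply/uniform_nbhs; exists [set xy | ball xy.1 (e / 2) xy.2]; split.
    by rewrite -entourage_ballE; exists (e / 2).
  by move=> h hE c; exact: hE.
have cv : continuous (fun z : set_type (range (@dm R k D L v)) =>
    measure_family_coords (set_val z)).
  have c1 : continuous (set_val : set_type (range (@dm R k D L v)) ->
      strong_measure_family R D) by exact: initial_continuous.
  have c2 : continuous (@measure_family_coords R k D : strong_measure_family R D -> _).
    exact: initial_continuous.
  by move=> z V /(c2 (set_val z)) /(c1 z).
rewrite gK in NW.
have {}NW : \forall z \near y, W (measure_family_coords (set_val z)) := cv y _ NW.
apply: (@filterS _ _ (nbhs_filter y) _ _ _ NW) => z /= Wz.
apply/UA/eU; rewrite /stab_dist.
apply: (@le_lt_trans _ _ (e / 2)%:E).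
  2: by rewrite lte_fin ltr_pdivrMr// ltr_pMr// ltr1n.
apply: ge_ereal_sup => r [E Er].
have : ball (meas_coords (dm (g y) (iso_class_of E))) (e / 2)
    (meas_coords (dm (g z) (iso_class_of E))).
  by rewrite (gK z); exact: Wz.
rewrite !dm_coords => -[[/= h1 h2] h3].
case: Er => ->; rewrite lee_fin.
- by apply: ltW; exact: h2.
- by apply: ltW; exact: h3.
- by rewrite ln_div ?posrE ?mass_gt0// distrC; apply: ltW; exact: h1.
Qed.

End MassMeasure.

Theorem theorem3 (R : realType) (k : fieldType) (D : triCat k)
  (L : zmodType) (L_rank : finite_positive_rank L)
  (v : {additive K0 D -> L}) (v_surj : forall y : L, exists x : K0 D, v x = y) :
  homeomorphism_onto_image (@dm R k D L v).
Proof.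
split; [exact: dm_continuous|exact: dm_injective|].
(* The inverse is a choice of preimages, and continuity holds for every such section. *)
have preimage (y : set_type (range (@dm R k D L v))) :
    exists sigma : Stab R v, dm sigma = set_val y.
  by have [sigma _ e] := set_mem (svalP y); exists sigma.
have [g gK] := boolp.choice preimage.
by exists g => //; exact: dm_inverse_continuous.
Qed.
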